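(* Let $C:f=0$ be a 3-syzygy curve of degree $d\geq 3$ in $\mathbb{P}^2$ with exponents $(d_1,d_2,d_3)$. Then the total Tjurina number $\tau(C)$ is given by the equivalent formulas $$\tau(C)=(d-1)^2-d_1(d-d_1-1)-(d_3-d_2+1)-(d_1+d_2-d)(d_1+d_3-d+2)$$ and $$\tau(C)=(d-1)(d-d_1-1)+d_1^2-[d_1-(d-1-d_2)][d_1-(d-1-d_3)].$$ In particular, the curve $C$ satisfies $$\tau(C)\leq (d-1)^2-d_1(d-d_1-1)-(d_3-d_2+1),$$ and equality holds if and only if $C$ is a plus-one generated curve.
   Context: Let $S=\mathbb{C}[x,y,z]$ with its standard grading, and let $C:f=0$ be a reduced curve of degree $d$ in $\mathbb{P}^2$, with $f\in S$ homogeneous of degree $d$. Put $AR(f)=\{(a,b,c)\in S^3: af_x+bf_y+cf_z=0\}$, a graded $S$-module in which $(a,b,c)$ has degree $k$ when $a,b,c\in S_k$. The curve $C$ is an $m$-syzygy curve if a minimal set of homogeneous generators of $AR(f)$ has $m$ elements; the degrees $d_1\leq\dots\leq d_m$ of these generators are the exponents of $C$. A plus-one generated curve is a 3-syzygy curve with $d_1+d_2=d$. The total Tjurina number $\tau(C)$ is the sum of the Tjurina numbers of the singular points of $C$. *)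

(* Defs.v *)
From HB Require Import structures.
From mathcomp Require Import all_boot all_order all_algebra.
From mathcomp Require Import mpoly complex.
From mathcomp Require Import boolp classical_sets functions cardinality fsbigop.
From mathcomp Require Import reals.

Set Implicit Arguments.
Unset Strict Implicit.
Unset Printing Implicit Defensive.

Import Order.TTheory GRing.Theory Num.Theory.
Local Open Scope classical_set_scope.
Local Open Scope ring_scope.
Local Notation "x %:F" := (tofrac x) : ring_scope.

Section PlaneCurves.
Variable K : fieldType.
Implicit Types f : {mpoly K[3]}.

(* The units of {mpoly K[3]} are the nonzero constants. *)
Definition squarefree f : Prop :=
  forall g h : {mpoly K[3]}, f = g * g * h -> g \is a GRing.unit.

Definition reduced_curve (d : nat) f : Prop :=
  [/\ f != 0, f \is d.-homog & squarefree f].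

(* AR(f), with triples (a, b, c) as row vectors over K[x, y, z]. *)
Definition AR f : set 'rV[{mpoly K[3]}]_3 :=
  [set s : 'rV[{mpoly K[3]}]_3 | \sum_(i < 3) s 0 i * f^`M(i) = 0].

Definition homogeneous_triple (k : nat) (s : 'rV[{mpoly K[3]}]_3) : Prop :=
  forall i, s 0 i \is k.-homog.

Definition generates_AR f m (r : 'I_m -> 'rV[{mpoly K[3]}]_3)
    (A : {set 'I_m}) : Prop :=
  forall s, AR f s ->
    exists c : 'I_m -> {mpoly K[3]}, s = \sum_(j in A) c j *: r j.

Definition minimal_generators f m (r : 'I_m -> 'rV[{mpoly K[3]}]_3) : Prop :=
  (forall j, AR f (r j)) /\
  (forall A : {set 'I_m}, generates_AR f r A <-> (forall j, j \in A)).

(* f defines an m-syzygy curve, m = size ds, with exponents ds. *)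
Definition exponents f (ds : seq nat) : Prop :=
  sorted leq ds /\
  exists r : 'I_(size ds) -> 'rV[{mpoly K[3]}]_3,
    minimal_generators f r /\
    (forall j : 'I_(size ds), homogeneous_triple (nth 0%N ds j) (r j)).

Definition plus_one_generated (d : nat) f : Prop :=
  exists d1 d2 d3 : nat, exponents f [:: d1; d2; d3] /\ (d1 + d2 = d)%N.

(* Local ring of the affine space K^n at q, inside its function field. *)
Definition local_ring n (q : 'I_n -> K) : set {fraction {mpoly K[n]}} :=
  [set u | exists a b : {mpoly K[n]}, b.@[q] != 0 /\ u = a%:F / b%:F].

Definition tjurina_ideal n (g : {mpoly K[n]}) (q : 'I_n -> K) :
    set {fraction {mpoly K[n]}} :=
  [set u | exists (a : {fraction {mpoly K[n]}})
                  (b : 'I_n -> {fraction {mpoly K[n]}}),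
     [/\ local_ring q a, (forall k, local_ring q (b k)) &
         u = a * g%:F + \sum_(k < n) b k * (g^`M(k))%:F]].

(* The quotient O / I of K-subspaces I `<=` O has a basis of N elements. *)
Definition has_quotient_dim n (O I : set {fraction {mpoly K[n]}}) (N : nat) :
    Prop :=
  exists e : 'I_N -> {fraction {mpoly K[n]}},
    (forall j, O (e j)) /\
    (forall u, O u -> exists! c : 'rV[K]_N,
       I (u - \sum_(j < N) ((c 0 j)%:MP)%:F * e j)).

(* Tjurina number of g = 0 at q; it is 0 by convention when the Tjurina
   algebra has infinite dimension, i.e. at a non-isolated singularity. *)
Definition tjurina n (g : {mpoly K[n]}) (q : 'I_n -> K) : nat :=
  xget 0%N [set N | has_quotient_dim (local_ring q) (tjurina_ideal g q) N].

(* Each point of P^2 is represented by its unique vector of homogeneous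
   coordinates whose first nonzero coordinate is 1. *)
Definition proj_plane : set 'rV[K]_3 :=
  [set p : 'rV[K]_3 | exists i : 'I_3, p 0 i = 1 /\ forall j : 'I_3, (j < i)%N -> p 0 j = 0].

Definition singular_points f : set 'rV[K]_3 :=
  [set p : 'rV[K]_3 | [/\ proj_plane p, f.@[p 0] = 0 & forall i, (f^`M(i)).@[p 0] = 0]].

(* Local equation of f = 0 in the chart x_i <> 0: set x_i to 1. *)
Definition dehomogenize (i : 'I_3) f : {mpoly K[2]} :=
  f \mPo [tuple if unlift i j is Some k then 'X_k else 1 | j < 3].

Definition curve_tjurina f (p : 'rV[K]_3) : nat :=
  if [pick i | p 0 i != 0] is Some i
  then tjurina (dehomogenize i f) (fun k : 'I_2 => p 0 (lift i k) / p 0 i)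
  else 0%N.

Definition total_tjurina f : nat :=
  (\sum_(p \in singular_points f) curve_tjurina f p)%N.

End PlaneCurves.

(* Main.v *)
(* Let S = K[x,y,z], J = (f_x, f_y, f_z) and m = d - 1. The total Tjurina number is the dimension
   of S_k/J_k for large k, and the generators r_0, r_1, r_2 of AR(f) determine this dimension.

   Since J has depth two, r_i x r_j = h_k grad f for some h_k, and sum_k h_k r_k = 0. The cofactor
   vectors of the Koszul syzygies give J in (h_0, h_1, h_2), whence every relation between the r_k
   is a multiple of h. This yields the resolution
     0 -> S(-e) -> S(-d_1) + S(-d_2) + S(-d_3) -> S^3 -> J(m) -> 0,  e = d_1 + d_2 + d_3 - m,
   so that dim S_k/J_k = m (d_1 + d_2 + d_3) - (d_1 d_2 + d_1 d_3 + d_2 d_3) for large k. By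
   minimality h_2, of degree d_1 + d_2 - m, is neither zero nor constant: d_1 + d_2 >= d.

   A line l = 0 on which f stays squarefree avoids the singular points, and S_k is contained in
   J + (l) for large k. Then multiplication by l is injective on S/J in large degrees, so that
   S_k/J_k = S/(J + (l - 1)), an algebra of finite dimension. The zeros of J + (l - 1) represent the
   singular points, and by the Nullstellensatz and the Chinese remainder theorem S_k/J_k is the
   product of the local Tjurina algebras. *)

Require Import Defs.
From HB Require Import structures.
From mathcomp Require Import all_boot all_order all_algebra all_field.
From mathcomp Require Import mpoly complex.
From mathcomp Require Import boolp classical_sets functions cardinality fsbigop.
From mathcomp Require Import reals.
From mathcomp Require Import ring zify.

Set Implicit Arguments.
Unset Strict Implicit.
Unset Printing Implicit Defensive.

Import Order.TTheory GRing.Theory Num.Theory.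
Local Open Scope ring_scope.

(** One elimination serves twice. Coordinates are chosen so that f does not vanish at the first row
    of a matrix [P]; then f, restricted to an affine chart and read as a polynomial in t over K[s],
    has a nonzero constant leading coefficient, and squarefreeness makes its discriminant nonzero.
    The Bezout identity for that discriminant yields both the depth two statement, as regularity of
    f and a directional derivative of f, and the line l, as a value of s off the discriminant.

    Local data are measured in a single degree: for fixed large k, the forms of degree k that lie in
    J locally at p are a subspace of S_k whose codimension is the Tjurina number at p. Hence the
    statements that hold in every sufficiently large degree.

    The stated upper bound minus tau is (d_1 + d_2 - d)(d_1 + d_3 - d + 2), whose second factor is
    positive. Equality thus means d_1 + d_2 = d, but since [plus_one_generated] quantifies over the
    exponents, one direction also needs them to be unique. *)

Section HomogeneousPolynomials.
Variables (n : nat) (K : comNzRingType).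
Implicit Types (p q : {mpoly K[n]}).

Lemma mderiv_homog d p i : p \is d.-homog -> p^`M(i) \is d.-1.-homog.
Proof.
move=> /dhomogP hp; apply/dhomogP => m.
rewrite mcoeff_msupp mcoeff_deriv => nz.
have : (m + U_(i))%MM \in msupp p.
  by rewrite mcoeff_msupp; apply: contra nz => /eqP ->; rewrite mul0rn.
by move/hp => /= <-; rewrite mdegD mdeg1 addn1.
Qed.

Lemma euler_identity d p :
  p \is d.-homog -> \sum_i 'X_i * p^`M(i) = p *+ d.
Proof.
move=> /dhomogP hp.
have hX (m : 'X_{1..n}) : \sum_i 'X_i * ('X_[m] : {mpoly K[n]})^`M(i)
    = 'X_[m] *+ mdeg m.
  under eq_bigr => i _.
    rewrite mderivX -scalerAr -mpolyXD.
    have -> : (m i)%:R *: 'X_[U_(i) + (m - U_(i))] = 'X_[m] *+ m i :> {mpoly K[n]}.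
      rewrite scaler_nat; have [->|mi] := eqVneq (m i) 0%N; first by rewrite !mulr0n.
      by rewrite addmC submK // lep1mP.
    over.
  by rewrite sumrMnr mdegE.
rewrite {1 2}[p]mpolyE -sumrMnl.
under eq_bigr => i _ do rewrite linear_sum mulr_sumr.
rewrite exchange_big /= !big_seq; apply: eq_bigr => m /hp <-.
rewrite scalerMnr -hX scaler_sumr; apply: eq_bigr => i _.
by rewrite mderivZ scalerAr.
Qed.

(** The case split is forced by truncated subtraction: for [k < e] the product has no component of
    degree [k], whereas [k - e] would be 0. *)
Lemma pihomogMl e k p q : p \is e.-homog ->
  pihomog mdeg k (p * q) = if (e <= k)%N then p * pihomog mdeg (k - e) q else 0.
Proof.
move=> hp; set N := (maxn (msize q) (k - e).+1).
rewrite {1}[q](@pihomog_partitionE _ _ mdeg N) ?leq_maxl // mulr_sumr raddf_sum /=.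
have hj j : p * pihomog mdeg j q \is (e + j).-homog by rewrite dhomogM // pihomogP.
case: leqP => ak; last first.
  rewrite big1 // => j _; apply: (pihomog_ne0 (d := (e + j)%N)); last exact: hj.
  by rewrite neq_ltn (leq_trans ak) ?orbT // leq_addr.
have lt : (k - e < N)%N by rewrite leq_max leqnn orbT.
rewrite (bigD1 (Ordinal lt)) //= big1 ?addr0.
  by apply: pihomog_dE; have := hj (k - e)%N; rewrite subnKC.
move=> j nj; apply: (pihomog_ne0 (d := (e + j)%N)); last exact: hj.
by apply: contra nj => /eqP e0; apply/eqP/val_inj => /=; rewrite -e0 addKn.
Qed.

Lemma meval_homog d p (c : K) (v : 'I_n -> K) : p \is d.-homog ->
  p.@[fun i => c * v i] = c ^+ d * p.@[v].
Proof.
move=> /dhomogP hp; rewrite !mevalE mulr_sumr !big_seq; apply: eq_bigr => m /hp <-.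
rewrite mulrCA; congr (_ * _).
under eq_bigr => i _ do rewrite exprMn.
by rewrite big_split /= -expr_sum -mdegE.
Qed.

End HomogeneousPolynomials.

(** Multiplication by [p] shifts the components of [q] to distinct degrees and, over a domain, kills
    none; so only the component in degree [b - e] can be nonzero. *)
Lemma homog_factor (n : nat) (K : idomainType) (p q : {mpoly K[n]}) e b :
  p \is e.-homog -> p != 0 -> p * q \is b.-homog ->
  if (e <= b)%N then q \is (b - e).-homog else q == 0.
Proof.
move=> hp p0 hpq.
have H j : (e + j)%N != b -> pihomog mdeg j q = 0.
  move=> nj; have := pihomogMl (e + j) q hp.
  rewrite leq_addr addKn (pihomog_ne0 _ hpq) 1?eq_sym // => /esym/eqP.
  by rewrite mulf_eq0 (negPf p0) => /eqP.
rewrite [q](@pihomog_partitionE _ _ mdeg (msize q)) //; case: leqP => ab.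
  apply: rpred_sum => j _; have [e0|ne] := eqVneq (e + j)%N b.
    by rewrite -e0 addKn; exact: pihomogP.
  by rewrite H // rpred0.
by rewrite big1 // => j _; apply: H; rewrite neq_ltn (leq_trans ab) ?orbT // leq_addr.
Qed.

(** * Polynomials determined by their values *)

Section Evaluation.
Variable K : numDomainType.

Lemma poly_eq0_horner (p : {poly K}) : (forall x, p.[x] = 0) -> p = 0.
Proof.
move=> hp; apply/eqP; apply/negPn/negP => p0.
have := max_poly_roots (rs := [seq j%:R | j <- iota 0 (size p)]) p0.
rewrite size_map size_iota ltnn => /(_ _ _)/negP; apply=> //.
  by apply/allP => x _; apply/rootP.
by rewrite map_inj_uniq ?iota_uniq //; exact: mulrIn (oner_neq0 _).
Qed.

Lemma mcoeff_muni n (p : {mpoly K[n.+1]}) (m : 'X_{1..n.+1}) :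
  (muni p)`_(m ord_max)@_[multinom m (widen_ord (leqnSn _) i) | i < n] = p@_m.
Proof.
rewrite [in RHS](mpolyE p) muniE coef_sum !raddf_sum /=; apply: eq_bigr => k _.
rewrite coefZ coefXn !mcoeffZ mcoeffX.
have [->|ne] := eqVneq k m.
  by rewrite !eqxx /= mulr1 mcoeffZ mcoeffX eqxx mulr1.
rewrite /= mulr0; case: (m ord_max =P k ord_max) => [e|_]; last by rewrite mulr0 raddf0.
rewrite mulr1 mcoeffZ mcoeffX; case: eqP => [e2|_]; last by rewrite mulr0.
case/negP: ne; apply/eqP/mnmP => i.
have [j ->|->] := unliftP ord_max i; last by [].
move/mnmP/(_ j): e2; rewrite !mnmE.
by have -> : widen_ord (leqnSn n) j = lift ord_max j by apply/ord_inj; rewrite lift_max.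
Qed.

(** Induction on the number of variables: at each point [v], [muni p] specializes to a univariate
    polynomial with infinitely many zeros, so its coefficients vanish at [v]. *)
Lemma mpoly_eq0_meval n (p : {mpoly K[n]}) : (forall v, p.@[v] = 0) -> p = 0.
Proof.
elim: n p => [|n IH] p hp.
  apply/mpolyP => m; have := hp (fun=> 0); rewrite [p in p.@[_]]mpolyE raddf_sum /=.
  rewrite mcoeff0 => <-; rewrite [in LHS](mpolyE p) raddf_sum /=; apply: eq_bigr => k _.
  by rewrite mcoeffZ mevalZ mcoeffX mevalX big_ord0; case: eqP => // -[]; apply/mnmP => -[].
suff h0 : muni p = 0.
  by apply/mpolyP => m; rewrite -mcoeff_muni h0 coef0 !mcoeff0.
apply/polyP => j; rewrite coef0; apply: IH => v.
have -> : ((muni p)`_j).@[v] = (map_poly (meval v) (muni p))`_j by rewrite coef_map.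
rewrite (@poly_eq0_horner (map_poly (meval v) (muni p))) ?coef0 // => x.
pose w (i : 'I_n.+1) := if unlift ord_max i is Some k then v k else x.
rewrite -(hp w) mevalE muniE raddf_sum /= horner_sum; apply: eq_bigr => m _.
rewrite -mul_polyC rmorphM /= map_polyC map_polyXn hornerCM hornerXn /=.
rewrite mevalZ mevalX -mulrA; congr (_ * _); rewrite big_ord_recr /= /w unlift_none.
congr (_ * _); apply: eq_bigr => i _; rewrite mnmE.
have -> : widen_ord (leqnSn n) i = lift ord_max i by apply/ord_inj; rewrite lift_max.
by rewrite liftK.
Qed.
End Evaluation.

(** * Ideals *)

Section Ideals.
Variable A : comNzRingType.
Implicit Types (I : A -> Prop) (x y : A).

Record is_ideal I : Prop := IsIdeal {
  ideal0 : I 0;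
  idealD : forall x y, I x -> I y -> I (x + y);
  idealM : forall a x, I x -> I (a * x) }.

Definition ideal_span m (g : 'I_m -> A) x := exists a : 'I_m -> A, x = \sum_i a i * g i.

Definition add_principal I e x := exists j b, I j /\ x = j + b * e.

Definition radical I x := exists k, I (x ^+ k).

Lemma ideal_span_ideal m (g : 'I_m -> A) : is_ideal (ideal_span g).
Proof.
split.
- by exists (fun=> 0); rewrite big1 // => i _; rewrite mul0r.
- move=> x y [a ->] [b ->]; exists (fun i => a i + b i).
  by rewrite -big_split; apply: eq_bigr => i _; rewrite mulrDl.
- move=> c x [a ->]; exists (fun i => c * a i).
  by rewrite mulr_sumr; apply: eq_bigr => i _; rewrite mulrA.
Qed.

Lemma ideal_span_gen m (g : 'I_m -> A) i : ideal_span g (g i).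
Proof.
exists (fun j => (j == i)%:R); rewrite (bigD1 i) //= eqxx mul1r big1 ?addr0 // => j /negPf->.
by rewrite mul0r.
Qed.

Lemma idealN I x : is_ideal I -> I x -> I (- x).
Proof. by move=> hI; rewrite -mulN1r; exact: idealM. Qed.

Lemma idealB I x y : is_ideal I -> I x -> I y -> I (x - y).
Proof. by move=> hI hx hy; apply: idealD => //; exact: idealN. Qed.

Lemma idealMr I a x : is_ideal I -> I x -> I (x * a).
Proof. by move=> hI; rewrite mulrC; exact: idealM. Qed.

Lemma idealBC I x y : is_ideal I -> I (x - y) -> I (y - x).
Proof. by move=> hI /(idealN hI); rewrite opprB. Qed.

Lemma ideal_trans I x y z : is_ideal I -> I (x - y) -> I (y - z) -> I (x - z).
Proof. by move=> hI h1 h2; rewrite -(subrKA y); exact: idealD. Qed.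

Lemma ideal_congr I x y : is_ideal I -> I (x - y) -> I y -> I x.
Proof. by move=> hI h1 h2; rewrite -(subrK y x); exact: idealD. Qed.

Lemma ideal_sum I (T : Type) (r : seq T) (P : pred T) (F : T -> A) :
  is_ideal I -> (forall i, P i -> I (F i)) -> I (\sum_(i <- r | P i) F i).
Proof.
by move=> hI hF; elim/big_ind: _ => //; [exact: ideal0 | exact: (idealD hI)].
Qed.

Lemma ideal_congrM I x y x' y' : is_ideal I ->
  I (x - x') -> I (y - y') -> I (x * y - x' * y').
Proof.
move=> hI hx hy; have -> : x * y - x' * y' = y * (x - x') + x' * (y - y') by ring.
by apply: idealD => //; exact: idealM.
Qed.

Lemma ideal_congrX I x y k : is_ideal I -> I (x - y) -> I (x ^+ k - y ^+ k).
Proof.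
move=> hI hxy; elim: k => [|k IH]; first by rewrite subrr; exact: ideal0.
by rewrite !exprS; exact: ideal_congrM.
Qed.

Lemma ideal_mmap I (K : comNzRingType) n (c : {rmorphism K -> A}) (h1 h2 : 'I_n -> A) p :
  is_ideal I -> (forall i, I (h1 i - h2 i)) -> I (mmap c h1 p - mmap c h2 p).
Proof.
move=> hI hh; rewrite /mmap -sumrB; apply: ideal_sum => // m _.
rewrite -mulrBr; apply: idealM => //; rewrite /mmap1.
elim/big_rec2: _ => [|i y1 y2 _ h]; first by rewrite subrr; exact: ideal0.
by apply: ideal_congrM => //; exact: ideal_congrX.
Qed.

Lemma add_principal_ideal I e : is_ideal I -> is_ideal (add_principal I e).
Proof.
move=> hI; split.
- by exists 0, 0; rewrite mul0r addr0; split=> //; exact: ideal0.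
- move=> x y [j [b [hj ->]]] [j' [b' [hj' ->]]]; exists (j + j'), (b + b').
  by split; [exact: idealD | rewrite mulrDl addrACA].
- move=> a x [j [b [hj ->]]]; exists (a * j), (a * b).
  by split; [exact: idealM | rewrite mulrDr mulrA].
Qed.

Lemma add_principal_sub I e x : I x -> add_principal I e x.
Proof. by exists x, 0; rewrite mul0r addr0. Qed.

Lemma add_principal_gen I e : is_ideal I -> add_principal I e e.
Proof. by move=> hI; exists 0, 1; rewrite mul1r add0r; split=> //; exact: ideal0. Qed.

Lemma radical_sub I x : I x -> radical I x.
Proof. by exists 1%N; rewrite expr1. Qed.

Lemma radicalX I x k : radical I (x ^+ k) -> radical I x.
Proof. by move=> [e he]; exists (k * e)%N; rewrite exprM. Qed.

Lemma radical_ideal I : is_ideal I -> is_ideal (radical I).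
Proof.
move=> hI; split.
- by apply: radical_sub; exact: ideal0.
- move=> x y [a ha] [b hb]; exists (a + b)%N; rewrite exprDn; apply: ideal_sum => // i _.
  rewrite -mulr_natl; apply: idealM => //.
  have [bi|bi] := leqP b i.
    by rewrite -(subnK bi) exprD mulrA; apply: idealM.
  have ai : (a <= a + b - i)%N by lia.
  by rewrite mulrC -(subnK ai) exprD mulrA; apply: idealM.
- by move=> a x [k hk]; exists k; rewrite exprMn; exact: idealM.
Qed.

End Ideals.

(** Pigeonhole: a monomial of degree above [n * N] contains some variable to a power at least
    [N]. *)
Lemma nilpotent_variables (K : comNzRingType) n (I : {mpoly K[n]} -> Prop) :
  is_ideal I -> (forall i, radical I 'X_i) ->
  exists N, forall k F, (N <= k)%N -> F \is k.-homog -> I F.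
Proof.
move=> hI hX.
have [N hN] : exists N, forall i, I ('X_i ^+ N).
  have /choice [k hk] : forall i, exists k, I ('X_i ^+ k) by [].
  exists (\sum_i k i)%N => i; rewrite (bigD1 i) //= addnC exprD.
  exact: idealM.
exists (n * N)%N.+1 => e F le /dhomogP hF; rewrite [F]mpolyE big_seq; apply: ideal_sum => // m.
move/hF => /= dm; rewrite -mul_mpolyC; apply: idealM => //.
have [i Ni] : exists i, (N <= m i)%N.
  apply/existsP; rewrite -[X in is_true X]negbK negb_exists; apply/negP => /forallP h.
  suff : (mdeg m <= n * N)%N by rewrite dm leqNgt le.
  have -> : (n * N = \sum_(i < n) N)%N by rewrite sum_nat_const card_ord.
  rewrite mdegE; apply: leq_sum => i _.
  by have := h i; rewrite -ltnNge => /ltnW.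
rewrite mpolyXE_id (bigD1 i) //= -(subnK Ni) exprD mulrAC mulrC.
exact: idealMr.
Qed.

Section Derivations.
Variables (K A : comNzRingType) (n : nat).
Variables (phi : {rmorphism {mpoly K[n]} -> A}) (D1 D2 : {additive {mpoly K[n]} -> A}).
Hypotheses (C1 : forall c, D1 c%:MP = 0) (C2 : forall c, D2 c%:MP = 0).
Hypothesis M1 : forall p q, D1 (p * q) = D1 p * phi q + phi p * D1 q.
Hypothesis M2 : forall p q, D2 (p * q) = D2 p * phi q + phi p * D2 q.

(** [D1] and [D2] are derivations along [phi], so the variables determine them. This gives the chain
    rule for both kinds of charts, [chart_fun_deriv] and [dehomogenize_deriv]. *)
Lemma derivation_ext : (forall i, D1 'X_i = D2 'X_i) -> D1 =1 D2.
Proof.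
move=> hX p; rewrite [p]mpolyE !raddf_sum; apply: eq_bigr => m _.
rewrite -mul_mpolyC M1 M2 C1 C2 !mul0r !add0r; congr (_ * _).
rewrite mpolyXE_id; elim/big_rec: _ => [|i x _ h].
  by rewrite -mpolyC1 C1 C2.
rewrite M1 M2 h; congr (_ * _ + _).
elim: (m i) => [|k IH]; first by rewrite expr0 -mpolyC1 C1 C2.
by rewrite exprS M1 M2 IH hX.
Qed.
End Derivations.

(** * Square factors of bivariate polynomials *)

Section PrimeElements.
Variable A : idomainType.

Definition divides (a b : A) := exists c, b = a * c.

Definition prime_element (pi : A) : Prop :=
  pi != 0 /\ forall a b, divides pi (a * b) -> divides pi a \/ divides pi b.

(* Gauss's lemma, in the form that keeps the square factor. *)
Lemma strip_square pi : prime_element pi ->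
  forall M F G H, pi ^+ M * F = G * G * H ->
  exists G' H' i, F = G' * G' * H' /\ G = pi ^+ i * G'.
Proof.
move=> [pi0 hpi]; elim=> [|M IH] F G H.
  by rewrite expr0 mul1r => ->; exists G, H, 0%N; rewrite expr0 mul1r.
rewrite exprS -mulrA => e.
have caseG G1 : G = pi * G1 ->
    exists G' H' i, F = G' * G' * H' /\ G = pi ^+ i * G'.
  move=> eG; have /(mulfI pi0)/IH [G' [H' [i [-> e1]]]] :
      pi * (pi ^+ M * F) = pi * (G1 * G1 * (pi * H)) by rewrite e eG; ring.
  by exists G', H', i.+1; rewrite eG e1 exprS mulrA.
have /hpi [[G1 /caseG //]|/hpi [[G1 /caseG //]|[H1 eH]]] :
    divides pi (G * (G * H)) by exists (pi ^+ M * F); rewrite e mulrA.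
apply: (IH F G H1); apply: (mulfI pi0); rewrite e eH; ring.
Qed.

Lemma strip_divisor pi f : prime_element pi -> ~ divides pi f ->
  forall M b, divides f (pi ^+ M * b) -> divides f b.
Proof.
move=> [pi0 hpi] nf; elim=> [|M IH] b; first by rewrite expr0 mul1r.
rewrite exprS -mulrA => -[q e].
have /hpi [//|[q1 eq1]] : divides pi (f * q) by exists (pi ^+ M * b).
apply: IH; exists q1; apply: (mulfI pi0); rewrite e eq1; ring.
Qed.

End PrimeElements.

Section Gauss.
Variable K : closedFieldType.
Implicit Types (F G H : {poly {poly K}}).

(** Write K[s][t] for [{poly {poly K}}]. Setting s = a maps it to the domain K[t], and the kernel
    consists of the multiples of s - a. *)
Lemma prime_element_linear (a : K) : prime_element (('X - a%:P)%:P : {poly {poly K}}).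
Proof.
split; first by rewrite polyC_eq0 polyXsubC_eq0.
have hdiv p : map_poly (horner_eval a) p = 0 -> divides ('X - a%:P)%:P p.
  move=> /polyP hp; exists (\poly_(i < size p) (p`_i %/ ('X - a%:P))).
  apply/polyP => i; rewrite coefCM coef_poly; case: ltnP => [_|le].
    rewrite mulrC divpK // dvdp_XsubCl; apply/rootP.
    by have := hp i; rewrite coef_map coef0.
  by rewrite mulr0 nth_default.
move=> p q [r e]; have : map_poly (horner_eval a) (p * q) = 0.
  by rewrite e rmorphM /= map_polyC /= /horner_eval !hornerE subrr polyC0 mul0r.
by rewrite rmorphM => /eqP; rewrite mulf_eq0 => /orP[] /eqP /hdiv; [left|right].
Qed.

(** As K is algebraically closed, [c] is a product of linear factors, which [strip_square] removes
    one at a time; being constant in t, they leave the size of [G] unchanged. *)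
Lemma gauss_square (c : {poly K}) F G H : c != 0 -> c%:P * F = G * G * H ->
  exists G' H', F = G' * G' * H' /\ size G' = size G.
Proof.
have [r ->] := closed_field_poly_normal c; move: (lead_coef c) => u nz.
have u0 : u != 0 by apply: contraNneq nz => ->; rewrite scale0r.
elim: r G H {nz} => [|a r IH] G H.
  rewrite big_nil => e; exists G, ((u^-1)%:P%:P * H); split=> //.
  have -> : F = (u^-1)%:P%:P * ((u *: 1)%:P * F).
    by rewrite alg_polyC mulrA -!polyCM mulVf // mul1r.
  rewrite e; ring.
rewrite big_cons scalerAr polyCM -mulrA => e.
have [G' [H' [i [e1 e2]]]] := strip_square (prime_element_linear a) (M := 1) e.
have [G'' [H'' [-> sz]]] := IH _ _ e1.
exists G'', H''; split=> //; rewrite sz e2 -polyC_exp size_Cmul //.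
by rewrite expf_neq0 // polyXsubC_eq0.
Qed.

Hypothesis K0 : [pchar K] =i pred0.

(** On [{poly {poly K}}], [%|] is divisibility up to a scalar from K[s], that is, over K(s). A
    vanishing resultant makes [F] inseparable there, and [gauss_square] clears the scalar. *)
Lemma square_factor F : F != 0 -> resultant F F^`() = 0 ->
  exists G H, F = G * G * H /\ (1 < size G)%N.
Proof.
move=> F0 /eqP; rewrite resultant_eq0 => /gtn_eqF /negP ncop.
have [u [v [uvF cop]]] : exists u v, u * v %| F /\ ~~ coprimep u v.
  apply: contrapT => h; apply: ncop.
  suff : separable_poly F by rewrite unlock /coprimep.
  apply/separable_polyP; split.
    by move=> u v uv; apply/negPn/negP => n; apply: h; exists u, v.
  (* In degree [(size u).-2] the derivative has the leading coefficient of [u] times [(size u).-1],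
     which is nonzero in characteristic 0. *)
  move=> u _ su; apply/eqP => /polyP/(_ (size u).-2).
  have e : (size u).-2.+1 = (size u).-1 by case: (size u) su => [|[]].
  rewrite coef_deriv coef0 e => /eqP; rewrite -mulr_natr mulf_eq0 -/(lead_coef u).
  rewrite lead_coef_eq0 -size_poly_eq0; case: (size u) su e => [|[|k]] // _ _ /=.
  by rewrite -polyC_natr polyC_eq0 (proj1 (@pcharf0P K) K0).
have g0 : gcdp u v != 0.
  rewrite gcdp_eq0; apply/negP => /andP[/eqP u0 _]; move: uvF.
  by rewrite u0 mul0r dvd0p (negPf F0).
have /Pdiv.Idomain.dvdpP [[c q] /= c0 e] : gcdp u v * gcdp u v %| F.
  by apply: dvdp_trans uvF; apply: dvdp_mul; [exact: dvdp_gcdl|exact: dvdp_gcdr].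
rewrite -mul_polyC mulrC in e.
have [G [H [-> sz]]] := gauss_square c0 (etrans (mulrC _ _) (etrans e (mulrC _ _))).
exists G, H; split=> //; rewrite sz.
by move: cop g0; rewrite /coprimep -size_poly_gt0; case: (size _) => [|[|k]].
Qed.
End Gauss.

(** * Lines in general position *)

Lemma sum_ord3 (V : nmodType) (F : 'I_3 -> V) : \sum_i F i = F 0 + F 1 + F 2.
Proof.
rewrite !big_ord_recl big_ord0 addr0 addrA.
by congr (F _ + F _ + F _); apply/val_inj.
Qed.

Lemma forall_ord3 (Q : 'I_3 -> Prop) : Q 0 -> Q 1 -> Q 2 -> forall i, Q i.
Proof.
move=> Q0 Q1 Q2 [[|[|[|i]]] hi] //.
- by rewrite (_ : Ordinal hi = 0) //; apply/val_inj.
- by rewrite (_ : Ordinal hi = 1) //; apply/val_inj.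
- by rewrite (_ : Ordinal hi = 2) //; apply/val_inj.
Qed.

Section Lifting.
Variables (K A : comNzRingType) (n : nat) (phi : {rmorphism {mpoly K[n]} -> A}).
Variables (Y : {mpoly K[n]}) (hY : Y \is 1.-homog) (phiY : phi Y = 1).

(** Since [phi Y = 1], multiplying a form by [Y] raises its degree without changing its image.
    Asking for lifts in all large degrees lets several lifts be brought to a common degree. *)
Definition liftable b :=
  exists N0, forall N, (N0 <= N)%N -> exists2 F, F \is N.-homog & phi F = b.

Lemma linear_form_expn k : Y ^+ k \is k.-homog.
Proof. by have := dhomogMn k hY; rewrite mul1n. Qed.

Lemma mpolyC_homog (c : K) : (c%:MP : {mpoly K[n]}) \is 0.-homog.
Proof. by rewrite -[c%:MP]mulr1 mul_mpolyC dhomogZ // dhomog1. Qed.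

Lemma liftable_homog k F : F \is k.-homog -> liftable (phi F).
Proof.
move=> hF; exists k => N kN; exists (F * Y ^+ (N - k)).
  by have := dhomogM hF (linear_form_expn (N - k)); rewrite subnKC.
by rewrite rmorphM rmorphXn /= phiY expr1n mulr1.
Qed.

Lemma liftableD a b : liftable a -> liftable b -> liftable (a + b).
Proof.
move=> [N ha] [M hb]; exists (maxn N M) => k; rewrite geq_max => /andP[/ha[F hF <-] /hb[G hG <-]].
by exists (F + G); rewrite ?rmorphD // rpredD.
Qed.

Lemma liftableM a b : liftable a -> liftable b -> liftable (a * b).
Proof.
move=> [N /(_ N (leqnn N)) [F hF <-]] [M /(_ M (leqnn M)) [G hG <-]].
by rewrite -rmorphM; apply: (@liftable_homog (N + M)); exact: dhomogM.
Qed.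

Lemma liftableC c : liftable (phi c%:MP).
Proof. exact: (liftable_homog (mpolyC_homog c)). Qed.

End Lifting.

Section Coordinates.
Variables (K : numClosedFieldType) (P : 'M[K]_3).
Hypothesis uP : P \in unitmx.

(* In the basis of K^3 given by the rows of P, [chart_fun] restricts a polynomial to the points
   t P_0 + P_1 + s P_2, with values in K[s][t]. *)
Definition chart_coord (k : 'I_3) : {poly {poly K}} :=
  if k == 0 then 'X else if k == 1 then 1 else 'X%:P.

Definition chart_point (j : 'I_3) : {poly {poly K}} :=
  \sum_k (P k j)%:P%:P * chart_coord k.

Definition chart_fun : {mpoly K[3]} -> {poly {poly K}} := mmap (polyC \o polyC) chart_point.
HB.instance Definition _ := GRing.RMorphism.copy chart_fun (mmap (polyC \o polyC) chart_point).

(** The linear forms dual to the rows of [P]; in the chart they become t, 1 and s. *)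
Definition coord_form (k : 'I_3) : {mpoly K[3]} := \sum_j invmx P j k *: 'X_j.

(** The derivative in the direction of row 0 of [P], which the chart turns into d/dt. *)
Definition dir_deriv (F : {mpoly K[3]}) := \sum_j P 0 j *: F^`M(j).

Local Notation phi := chart_fun.
Local Notation Y := coord_form.

Lemma chart_fun1 : phi 1 = 1. Proof. exact: rmorph1. Qed.

Lemma chart_funD : {morph phi : F G / F + G}. Proof. exact: rmorphD. Qed.

Lemma chart_funB : {morph phi : F G / F - G}. Proof. exact: rmorphB. Qed.

Lemma chart_funM : {morph phi : F G / F * G}. Proof. exact: rmorphM. Qed.

Lemma chart_funXn k : {morph phi : F / F ^+ k}. Proof. exact: rmorphXn. Qed.

Lemma chart_funX j : phi 'X_j = chart_point j.
Proof. by rewrite /phi mmapX mmap1U. Qed.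

Lemma chart_funC c : phi c%:MP = c%:P%:P.
Proof. by rewrite /phi mmapC. Qed.

Lemma chart_funZ c F : phi (c *: F) = c%:P%:P * phi F.
Proof. by rewrite -mul_mpolyC rmorphM /= chart_funC. Qed.

Lemma mul_invmx_entry i k : \sum_j P i j * invmx P j k = (i == k)%:R.
Proof. by have := congr1 (fun M : 'M_3 => M i k) (mulmxV uP); rewrite !mxE. Qed.

Lemma mul_invmx_entry' i k : \sum_j invmx P i j * P j k = (i == k)%:R.
Proof. by have := congr1 (fun M : 'M_3 => M i k) (mulVmx uP); rewrite !mxE. Qed.

Lemma chart_coord_form k : phi (Y k) = chart_coord k.
Proof.
rewrite raddf_sum /=; under eq_bigr => j _ do rewrite chart_funZ chart_funX mulr_sumr.
rewrite exchange_big /=.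
transitivity (\sum_i (i == k)%:R%:P%:P * chart_coord i).
  apply: eq_bigr => i _; rewrite -mul_invmx_entry !raddf_sum mulr_suml /=.
  by apply: eq_bigr => j _; rewrite mulrA -!polyCM [P _ _ * _]mulrC.
rewrite (bigD1 k) //= eqxx mul1r big1 ?addr0 // => i /negPf ->.
by rewrite !polyC0 mul0r.
Qed.

Lemma coord_form_homog k : Y k \is 1.-homog.
Proof. by apply: rpred_sum => j _; rewrite dhomogZ // dhomogX /= mdeg1. Qed.

Lemma sum_coord_form j : \sum_k P k j *: Y k = 'X_j.
Proof.
under eq_bigr => k _ do rewrite /Y scaler_sumr.
rewrite exchange_big /=.
transitivity (\sum_i (i == j)%:R *: 'X_i : {mpoly K[3]}).
  apply: eq_bigr => i _; rewrite -mul_invmx_entry' scaler_suml.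
  by apply: eq_bigr => k _; rewrite scalerA mulrC.
rewrite (bigD1 j) //= eqxx scale1r big1 ?addr0 // => i /negPf ->.
by rewrite scale0r.
Qed.

Lemma chart_fun_eval F s t :
  (phi F).[t%:P].[s] = F.@[fun j => t * P 0 j + P 1 j + s * P 2 j].
Proof.
rewrite /phi mevalE /mmap !horner_sum; apply: eq_bigr => m _.
rewrite /= hornerCM hornerCM /mmap1 !horner_prod; congr (_ * _); apply: eq_bigr => j _.
rewrite !horner_exp; congr (_ ^+ _).
rewrite /chart_point sum_ord3 /chart_coord /= !hornerE /=.
ring.
Qed.

(** By homogeneity a form that vanishes on the chart vanishes wherever [Y 1] does not, so its
    product with [Y 1] is zero at every point. *)
Lemma chart_fun_inj k F : F \is k.-homog -> phi F = 0 -> F = 0.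
Proof.
move=> hF F0; suff : F * Y 1 = 0.
  move/eqP; rewrite mulf_eq0 => /orP[/eqP //|/eqP Y0].
  have := chart_coord_form 1; rewrite Y0 rmorph0 => /eqP.
  by rewrite eq_sym oner_eq0.
apply: mpoly_eq0_meval => x; rewrite mevalM.
set y := fun k => (Y k).@[x].
have [y1|y1] := eqVneq (y 1) 0; first by rewrite -/(y 1) y1 mulr0.
have xE j : x j = y 1 * (y 0 / y 1 * P 0 j + P 1 j + y 2 / y 1 * P 2 j).
  rewrite -[LHS](mevalXU x) -sum_coord_form raddf_sum /= sum_ord3 !mevalZ.
  by rewrite -/(y 0) -/(y 1) -/(y 2); field.
rewrite (meval_eq _ xE) (meval_homog _ _ hF) -chart_fun_eval F0 !horner0.
by rewrite mulr0 mul0r.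
Qed.

Lemma chart_fun_liftable b : liftable phi b.
Proof.
have h1 : phi (Y 1) = 1 by rewrite chart_coord_form.
have hY := coord_form_homog 1.
have lC c : liftable phi c%:P%:P by rewrite -chart_funC; exact: (liftableC hY h1).
have lY k : liftable phi (chart_coord k).
  by rewrite -chart_coord_form; exact: (liftable_homog hY h1 (coord_form_homog k)).
have lcst (c : {poly K}) : liftable phi c%:P.
  elim/poly_ind: c => [|c a IH]; first exact: lC.
  by rewrite polyCD polyCM; apply/liftableD => //; apply/(liftableM hY h1) => //; exact: (lY 2).
elim/poly_ind: b => [|b c IH]; first exact: lC.
by apply: liftableD => //; apply/(liftableM hY h1) => //; exact: (lY 0).
Qed.

Lemma chart_fun_lift b :
  exists N0, forall N, (N0 <= N)%N -> exists2 F, F \is N.-homog & chart_fun F = b.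
Proof. exact: chart_fun_liftable. Qed.

Lemma dir_deriv_is_linear : linear dir_deriv.
Proof.
move=> c p q; rewrite /dir_deriv scaler_sumr -big_split /=; apply: eq_bigr => j _.
by rewrite linearP scalerDr !scalerA mulrC.
Qed.
HB.instance Definition _ := GRing.isLinear.Build K {mpoly K[3]} {mpoly K[3]} _
  dir_deriv dir_deriv_is_linear.

Lemma chart_fun_deriv F : (phi F)^`() = phi (dir_deriv F).
Proof.
pose D1 : {additive {mpoly K[3]} -> {poly {poly K}}} := @deriv _ \o phi.
pose D2 : {additive {mpoly K[3]} -> {poly {poly K}}} := phi \o dir_deriv.
apply: (derivation_ext (phi := phi) (D1 := D1) (D2 := D2)) => [c|c|p q|p q|i] /=.
- by rewrite chart_funC derivC.
- rewrite /dir_deriv big1 ?rmorph0 // => j _; rewrite mderivC scaler0 //.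
- by rewrite rmorphM derivM.
- rewrite -!rmorphM -rmorphD; congr (phi _).
  rewrite /dir_deriv mulr_suml mulr_sumr -big_split; apply: eq_bigr => j _ /=.
  by rewrite mderivM scalerDr scalerAl scalerAr.
- rewrite chart_funX /dir_deriv (bigD1 i) //= big1 ?addr0 => [|j ji].
    rewrite mderivX mnm1E eqxx scale1r.
    have -> : (U_(i) - U_(i))%MM = 0%MM by apply/mnmP => j; rewrite mnmBE subnn mnm0E.
    rewrite mpolyX0 chart_funZ rmorph1 mulr1.
    rewrite /chart_point sum_ord3 /chart_coord /= !derivE.
    by ring.
  by rewrite mderivX mnm1E eq_sym (negPf ji) scale0r scaler0.
Qed.

(** Each [chart_point j] has degree at most 1 in t, with top coefficient [P 0 j] free of s. Hence a
    form that does not vanish at row 0 of [P] has an invertible leading coefficient in t. *)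
Lemma chart_fun_top k F : F \is k.-homog ->
  (size (phi F) <= k.+1)%N /\ (phi F)`_k = (F.@[P 0])%:P.
Proof.
pose top k (p : {poly {poly K}}) c := (size p <= k.+1)%N /\ p`_k = c%:P.
have topM i j p q c e : top i p c -> top j q e -> top (i + j)%N (p * q) (c * e).
  move=> [sp pi] [sq qj]; split; first by apply: leq_trans (size_polyMleq _ _) _; lia.
  have lt : (i < (i + j).+1)%N by rewrite ltnS leq_addr.
  rewrite coefM (bigD1 (Ordinal lt)) //= addKn pi qj polyCM big1 ?addr0 // => l li.
  have [il|il] := ltnP i l; first by rewrite nth_default ?mul0r // (leq_trans sp).
  have li' : (l < i)%N by rewrite ltn_neqAle il andbT.
  by rewrite (@nth_default _ _ q) ?mulr0 //; apply: leq_trans sq _; lia.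
have topX j : top 1%N (chart_point j) (P 0 j).
  have -> : chart_point j = ((P 1 j)%:P + (P 2 j) *: 'X)%:P + (P 0 j)%:P *: 'X.
    by rewrite /chart_point sum_ord3 /chart_coord /= -!mul_polyC polyCD polyCM; ring.
  split; last by rewrite coefD coefC coefZ coefX /= mulr1 add0r.
  apply: leq_trans (size_polyD _ _) _; rewrite geq_max.
  apply/andP; split; first by apply: leq_trans (size_polyC_leq1 _) _.
  by apply: leq_trans (size_scale_leq _ _) _; rewrite size_polyX.
have top1 : top 0%N 1 1 by split; rewrite ?size_poly1 ?coefC.
have topE j n : top n (chart_point j ^+ n) (P 0 j ^+ n).
  by elim: n => [|n IH] //; rewrite !exprS; exact: (topM 1%N n).
have topXm (m : 'X_{1..3}) : top (mdeg m) (mmap1 chart_point m) 'X_[m].@[P 0].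
  rewrite mevalX mdegE /mmap1; elim/big_rec3: _ => // j a b c _.
  exact/topM/topE.
have topD p q c e : top k p c -> top k q e -> top k (p + q) (c + e).
  move=> [sp pk] [sq qk]; split; last by rewrite coefD pk qk polyCD.
  by apply: leq_trans (size_polyD _ _) _; rewrite geq_max sp.
move=> /dhomogP hF; suff : top k (phi F) F.@[P 0] by [].
rewrite /phi /mmap mevalE !big_seq; elim/big_rec2: _ => [|m c p hm IH].
  by split; rewrite ?size_poly0 ?coef0.
apply: topD => //; rewrite -mevalX -(hF m hm) /=.
apply: (topM 0%N); last exact: topXm.
by split; [exact: size_polyC_leq1 | rewrite coefC].
Qed.
End Coordinates.

Lemma mmap_mpolyX (K : comNzRingType) n (F : {mpoly K[n]}) :
  mmap (@mpolyC n K) (fun i => 'X_i) F = F.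
Proof.
rewrite [RHS]mpolyE; apply: eq_bigr => m _.
by rewrite mmap1_id mul_mpolyC.
Qed.

Lemma mmap_homog_line (K : comNzRingType) n k (F y : {mpoly K[n]}) (c : 'I_n -> K) :
  F \is k.-homog -> mmap (@mpolyC n K) (fun i => c i *: y) F = F.@[c] *: y ^+ k.
Proof.
move=> /dhomogP hF; rewrite mevalE scaler_suml /mmap !big_seq; apply: eq_bigr => m /hF /= <-.
rewrite mul_mpolyC -scalerA; congr (_ *: _); rewrite mdegE expr_sum -scaler_prod.
by apply: eq_bigr => i _; rewrite exprZn.
Qed.

Definition jacobian_ideal (K : fieldType) n (f : {mpoly K[n]}) :=
  ideal_span (fun i => f^`M(i)).

Lemma jacobian_ideal_ideal (K : fieldType) n (f : {mpoly K[n]}) : is_ideal (jacobian_ideal f).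
Proof. exact: ideal_span_ideal. Qed.

Lemma jacobian_ideal_self (K : numFieldType) n d (f : {mpoly K[n]}) :
  (0 < d)%N -> f \is d.-homog -> jacobian_ideal f f.
Proof.
move=> d0 /euler_identity e; exists (fun i => d%:R^-1 *: 'X_i).
have d1 : d%:R != 0 :> K by rewrite pnatr_eq0 -lt0n.
rewrite -[LHS](scalerK d1) scaler_nat -e scaler_sumr; apply: eq_bigr => i _.
by rewrite scalerAl.
Qed.

Section GoodPosition.
Variables (K : numClosedFieldType) (P : 'M[K]_3) (d : nat) (f : {mpoly K[3]}).
Hypotheses (uP : P \in unitmx) (d1 : (1 < d)%N) (hf : f \is d.-homog).
Hypotheses (sqf : squarefree f) (fP : f.@[P 0] != 0).

Local Notation phi := (chart_fun P).
Local Notation Y := (coord_form P).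
Local Notation g := (dir_deriv P f).

Lemma coord_form_point i k : (Y k).@[P i] = (i == k)%:R.
Proof.
rewrite -(mul_invmx_entry uP) raddf_sum /=; apply: eq_bigr => j _.
by rewrite mevalZ mevalXU mulrC.
Qed.

(** [eps] below projects along row 1 of [P] onto the plane where [Y 1] vanishes. It is congruent to
    the identity modulo [Y 1], so its kernel is the ideal of [Y 1], prime because the target is a
    domain. *)
Lemma prime_coord_form : prime_element (Y 1).
Proof.
split.
  apply/eqP => Y0; have := chart_coord_form uP 1; rewrite Y0 rmorph0 => /eqP.
  by rewrite eq_sym oner_eq0.
pose eps := mmap (@mpolyC 3 K) (fun j => 'X_j - P 1 j *: Y 1).
have epsY : eps (Y 1) = 0.
  rewrite /eps [Y 1]/coord_form raddf_sum /=.
  under eq_bigr => j _ do rewrite mmapZ mmapX mmap1U mulrBr !mul_mpolyC scalerA.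
  rewrite sumrB -scaler_suml.
  have -> : \sum_j invmx P j 1 * P 1 j = 1.
    by have := mul_invmx_entry uP 1 1; under eq_bigr => j _ do rewrite mulrC.
  by rewrite scale1r subrr.
have hI : is_ideal (divides (Y 1)).
  split; first by exists 0; rewrite mulr0.
    by move=> x y [a ->] [b ->]; exists (a + b); rewrite mulrDr.
  by move=> a x [b ->]; exists (a * b); rewrite mulrCA.
have hdiv F : eps F = 0 -> divides (Y 1) F.
  move=> e; rewrite -[F]subr0 -e -{1}[F]mmap_mpolyX; apply: ideal_mmap => // j.
  by rewrite opprB addrC subrK; exists (P 1 j)%:MP; rewrite mulrC mul_mpolyC.
move=> a b [c e]; have : eps (a * b) = 0 by rewrite e /eps rmorphM /= -/eps epsY mul0r.
by rewrite /eps rmorphM /= => /eqP; rewrite mulf_eq0 => /orP[] /eqP /hdiv; [left|right].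
Qed.

Lemma coord_form_ndivides : ~ divides (Y 1) f.
Proof. by move=> [h e]; move/negP: fP; rewrite e mevalM coord_form_point mul0r. Qed.

Lemma chart_fun_coord_form1 : phi (Y 1) = 1.
Proof. exact: chart_coord_form. Qed.

Lemma homog_coord_form1 n : Y 1 ^+ n \is n.-homog.
Proof. exact/linear_form_expn/coord_form_homog. Qed.

Lemma chart_top_coef : (phi f)`_d != 0.
Proof. by rewrite (chart_fun_top uP hf).2 polyC_eq0. Qed.

Lemma size_chart_fun : size (phi f) = d.+1.
Proof.
apply/eqP; rewrite eqn_leq (chart_fun_top uP hf).1 /= ltnNge.
by apply: contra chart_top_coef => h; rewrite nth_default.
Qed.

Lemma chart_fun_neq0 : phi f != 0.
Proof. by rewrite -size_poly_gt0 size_chart_fun. Qed.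

(** A zero resultant gives a square factor in the chart. Lifting it to forms introduces only powers
    of the prime [Y 1], which are stripped off; squarefreeness then makes the lifted factor a unit,
    against its positive degree in t. *)
Lemma chart_resultant : resultant (phi f) (phi f)^`() != 0.
Proof.
apply/eqP => /(square_factor (@pchar_num K) chart_fun_neq0) [G [H [e sz]]].
have [N1 h1] := chart_fun_lift uP G; have [N2 h2] := chart_fun_lift uP H.
have [G1 hG1 eG] := h1 N1 (leqnn _).
(* The degree [N2 + d] makes both sides of the identity below homogeneous of degree
   [N1 + N1 + N2 + d]. *)
have [H1 hH1 eH] := h2 (N2 + d)%N (leq_addr _ _).
have : Y 1 ^+ (N1 + N1 + N2) * f = G1 * G1 * H1.
  apply/eqP; rewrite -subr_eq0; apply/eqP.
  apply: (@chart_fun_inj _ _ uP (N1 + N1 + N2 + d)).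
    by rewrite rpredB // ?(dhomogM (homog_coord_form1 _)) // -addnA !dhomogM.
  by rewrite chart_funB !chart_funM chart_funXn chart_fun_coord_form1 expr1n mul1r eG eH e subrr.
move=> /(strip_square prime_coord_form) [G2 [H2 [i [/sqf uG2 e2]]]].
have /eqP s1 : size (phi G2) == 1%N.
  have : size (phi (G2^-1 * G2)) == 1%N by rewrite mulVr // chart_fun1 size_poly1.
  by rewrite chart_funM size_mul_eq1 => /andP[].
by move: sz; rewrite -eG e2 chart_funM chart_funXn chart_fun_coord_form1 expr1n mul1r s1.
Qed.

Lemma chart_bezout : exists u v : {poly {poly K}},
  (resultant (phi f) (phi f)^`())%:P = u * phi f + v * phi g.
Proof.
have s1 : (1 < size (phi f))%N by rewrite size_chart_fun; lia.
have s2 : (1 < size (phi f)^`())%N.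
  apply: leq_trans d1 _; rewrite leqNgt; apply/negP => h.
  have : (phi f)^`()`_d.-1 = 0 by rewrite nth_default // -ltnS prednK // ltnW.
  move=> /eqP; rewrite coef_deriv prednK ?(ltnW d1) // -mulr_natr mulf_eq0 (negPf chart_top_coef).
  by rewrite -!polyC_natr !polyC_eq0 pnatr_eq0 gtn_eqF // ltnW.
have [[u v] /= _ e] := resultant_in_ideal s1 s2.
by exists u, v; rewrite -(chart_fun_deriv P).
Qed.

(** The Bezout identity makes [rho%:P * phi b] a multiple of [phi f]. As [phi f] has an invertible
    leading coefficient, [phi b] can be divided by it; [rho%:P] times the remainder is a multiple of
    [phi f] of smaller degree, hence 0. Lifting the quotient costs a power of [Y 1], removed by
    [strip_divisor]. *)
Lemma regular_homog k a b : b \is k.-homog -> f * a = g * b -> divides f b.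
Proof.
move=> hb e; have [u [v ebz]] := chart_bezout; set rho := resultant _ _ in ebz.
have rho0 : rho != 0 := chart_resultant.
have e1 : rho%:P * phi b = phi f * (u * phi b + v * phi a).
  have -> : phi f * (u * phi b + v * phi a) = u * phi f * phi b + v * (phi f * phi a).
    by ring.
  by rewrite -chart_funM e chart_funM ebz mulrDl mulrA.
have ulc : lead_coef (phi f) \is a GRing.unit.
  rewrite /lead_coef size_chart_fun /= (chart_fun_top uP hf).2.
  by rewrite poly_unitE size_polyC fP coefC /= unitfE.
have edv := Pdiv.IdomainUnit.divp_eq ulc (phi b).
have /eqP r0 : phi b %% phi f == 0.
  apply/negP => /negP r0.
  have := ltn_modp (phi b) (phi f); rewrite chart_fun_neq0.
  rewrite -(size_Cmul (phi b %% phi f) rho0) ltnNge => /negP; apply.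
  have : rho%:P * (phi b %% phi f) =
      phi f * (u * phi b + v * phi a - rho%:P * (phi b %/ phi f)).
    by rewrite mulrBr -e1 {2}edv; ring.
  move=> e2; have : rho%:P * (phi b %% phi f) != 0 by rewrite mulf_neq0 ?polyC_eq0.
  rewrite e2 mulf_eq0 negb_or => /andP[n1 n2].
  by rewrite size_mul // -subn1 -addnBA ?leq_addr // lt0n size_poly_eq0.
rewrite r0 addr0 in edv.
have [N hN] := chart_fun_lift uP (phi b %/ phi f).
have [q hq eq] := hN (N + k)%N (leq_addr _ _).
apply: (strip_divisor prime_coord_form coord_form_ndivides (M := (N + d)%N)); exists q.
apply/eqP; rewrite -subr_eq0; apply/eqP.
apply: (@chart_fun_inj _ _ uP (N + d + k)).
  rewrite rpredB // ?(dhomogM (homog_coord_form1 _)) //.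
  by rewrite addnAC [(_ + d)%N]addnC dhomogM.
rewrite chart_funB !chart_funM chart_funXn chart_fun_coord_form1 expr1n mul1r eq.
by rewrite [phi f * _]mulrC -edv subrr.
Qed.

Lemma dir_deriv_homog : g \is d.-1.-homog.
Proof. by apply: rpred_sum => j _; rewrite dhomogZ // mderiv_homog. Qed.

Lemma dir_deriv_neq0 : g != 0.
Proof.
apply/eqP => g0; have := chart_fun_deriv P f; rewrite g0 rmorph0 => /polyP/(_ d.-1)/eqP.
rewrite coef0 coef_deriv prednK ?(ltnW d1) // -mulr_natr mulf_eq0 (negPf chart_top_coef).
by rewrite -!polyC_natr !polyC_eq0 pnatr_eq0 gtn_eqF // ltnW.
Qed.

(* Together with Euler's relation, this says that the Jacobian ideal has depth two. *)
Lemma regular_sequence a b : f * a = g * b -> divides f b.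
Proof.
move=> e; rewrite [b](@pihomog_partitionE _ _ mdeg (msize b)) //.
have hI : is_ideal (divides f).
  split; first by exists 0; rewrite mulr0.
    by move=> x y [c ->] [c' ->]; exists (c + c'); rewrite mulrDr.
  by move=> c x [c' ->]; exists (c * c'); rewrite mulrCA.
apply: ideal_sum => // k _; set n := nat_of_ord k.
have := congr1 (pihomog mdeg (d.-1 + n)) e.
rewrite (pihomogMl _ _ hf) (pihomogMl _ _ dir_deriv_homog) leq_addr addKn.
case: leqP => _ e2; first exact: (regular_homog (pihomogP _ _ _) e2).
move/esym/eqP: e2; rewrite mulf_eq0 (negPf dir_deriv_neq0) => /eqP ->.
exact: ideal0.
Qed.

(* A vertical line s = s0 off the discriminant of f with respect to t meets the curve in d
   distinct points, hence misses its singular points. *)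
Lemma good_line : exists l N, [/\ l \is 1.-homog, l != 0 &
  forall k F, (N <= k)%N -> F \is k.-homog -> add_principal (jacobian_ideal f) l F].
Proof.
have [u [v]] := chart_bezout; set rho := resultant _ _ => ebz.
have [s0 rs0] : exists s0, rho.[s0] != 0.
  apply: contrapT => h; move/eqP: chart_resultant; apply; apply: poly_eq0_horner => x.
  by apply/eqP/negPn/negP => hx; apply: h; exists x.
pose l := Y 2 - s0 *: Y 1.
have hl : l \is 1.-homog by rewrite rpredB ?dhomogZ ?coord_form_homog.
exists l; pose I := add_principal (jacobian_ideal f) l.
have hJ := jacobian_ideal_ideal f.
have hI : is_ideal I by exact: add_principal_ideal.
have hR := radical_ideal hI.
have phil : phi l = ('X - s0%:P)%:P.
  rewrite chart_funB (chart_funZ P) !(chart_coord_form uP) /chart_coord /=.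
  by rewrite mulr1 polyCB.
have l0 : l != 0.
  apply/eqP => e; move/eqP: phil; rewrite e -(subrr f) chart_funB subrr eq_sym polyC_eq0.
  by rewrite polyXsubC_eq0.
suff /(nilpotent_variables hI) [N hN] : forall i, radical I 'X_i by exists N.
have [rho1 erho] : exists rho1, rho - rho.[s0]%:P = rho1 * ('X - s0%:P).
  by apply/factor_theorem; rewrite /root !hornerE subrr.
(* The Bezout identity at s = s0, homogenized: the nonzero constant [rho.[s0]] times a power of
   [Y 1] is a combination of f, g and l. *)
have rY : radical I (Y 1).
  have [N1 h1] := chart_fun_lift uP u; have [N2 h2] := chart_fun_lift uP v.
  have [N3 h3] := chart_fun_lift uP rho1%:P.
  pose N := (N1 + N2 + N3)%N.
  have [U hU eU] := h1 N ltac:(lia); have [V hV eV] := h2 N.+1 ltac:(lia).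
  have [W hW eW] := h3 (N + d.-1)%N ltac:(lia).
  exists (N + d)%N.
  have eY : rho.[s0] *: Y 1 ^+ (N + d) = U * f + V * g - W * l.
    apply/eqP; rewrite -subr_eq0; apply/eqP; apply: (@chart_fun_inj _ _ uP (N + d)).
      have hVg : V * g \is (N + d).-homog.
        by have := dhomogM hV dir_deriv_homog; rewrite addSnnS prednK // ltnW.
      have hWl : W * l \is (N + d).-homog.
        by have := dhomogM hW hl; rewrite -addnA addn1 prednK // ltnW.
      apply: rpredB; first by apply: dhomogZ; exact: homog_coord_form1.
      by apply: rpredB => //; apply: rpredD => //; exact: dhomogM.
    rewrite !chart_funB chart_funD !chart_funM (chart_funZ P) chart_funXn.
    rewrite chart_fun_coord_form1 expr1n mulr1 eU eV eW phil -ebz -polyCM -erho polyCB.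
    by ring.
  rewrite -(scalerK rs0 (_ ^+ _)) eY -mul_mpolyC; apply: (idealM hI).
  have hf' : I f by apply: add_principal_sub; exact: (jacobian_ideal_self (ltnW d1) hf).
  have hg : I g.
    apply: add_principal_sub; apply: ideal_sum => // j _; rewrite -mul_mpolyC; apply: (idealM hJ).
    exact: ideal_span_gen.
  apply: (idealB hI); last by apply: (idealM hI); exact: (add_principal_gen _ hJ).
  by apply: (idealD hI); exact: (idealM hI).
have rZ c (p : {mpoly K[3]}) : radical I p -> radical I (c *: p).
  by rewrite -mul_mpolyC; exact: (idealM hR).
have rY2 : radical I (Y 2).
  rewrite -(subrK (s0 *: Y 1) (Y 2)); apply: (idealD hR); last exact: rZ.
  by apply: radical_sub; exact: (add_principal_gen _ hJ).
(* Modulo [Y 1] and [Y 2] the variable ['X_j] is [P 0 j *: Y 0], so f reduces to [f.@[P 0] *: Y 0 ^+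
   d]. *)
have rY0 : radical I (Y 0).
  apply: (@radicalX _ _ _ d).
  rewrite -(scalerK fP (_ ^+ _)); apply: (rZ _ _); rewrite -(mmap_homog_line _ _ hf).
  apply: (ideal_congr (y := f) hR); last first.
    by apply: radical_sub; apply: add_principal_sub; exact: (jacobian_ideal_self (ltnW d1) hf).
  apply: (idealBC hR); rewrite -{1}[f]mmap_mpolyX; apply: ideal_mmap => [|j]; first exact: hR.
  rewrite -(sum_coord_form uP) sum_ord3.
  have -> (a b c : {mpoly K[3]}) : a + b + c - a = b + c by ring.
  by apply: (idealD hR); exact: rZ.
move=> i; rewrite -(sum_coord_form uP) sum_ord3.
by apply: (idealD hR); [apply: (idealD hR)|]; exact: rZ.
Qed.

End GoodPosition.

(** * Syzygies of the Jacobian ideal *)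

Lemma generic_frame (K : numClosedFieldType) d (f : {mpoly K[3]}) :
  f != 0 -> f \is d.-homog -> exists2 P : 'M[K]_3, P \in unitmx & f.@[P 0] != 0.
Proof.
move=> f0 hf; have [v fv] : exists v, f.@[v] != 0.
  apply: contrapT => h; move/eqP: f0; apply; apply: mpoly_eq0_meval => v.
  by apply/eqP/negPn/negP => fv; apply: h; exists v.
(* [v] is a multiple [c] of row 0 of [row_ebase A], with [c = 0] when [A] is zero; so f cannot
   vanish at that row. *)
pose A : 'rV[K]_3 := \row_j v j; exists (row_ebase A); first exact: row_ebase_unit.
pose c := col_ebase A 0 0 * (0 < \rank A)%:R.
have vE j : v j = c * row_ebase A 0 j.
  have -> : v j = A 0 j by rewrite mxE.
  rewrite -[in LHS](mulmx_ebase A) -mulmxA mxE big_ord1 mxE (bigD1 0) //= mxE /= big1 => [|k k0].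
    by rewrite addr0 mulrA.
  by rewrite mxE eq_sym -val_eqE /= in k0 *; rewrite (negPf k0) mul0r.
by apply: contraNneq fv => e; rewrite (meval_eq _ vE) (meval_homog _ _ hf) e mulr0.
Qed.

Section CrossProduct.
Variable A : idomainType.
Implicit Types (u v w F : 'I_3 -> A) (r : 'I_3 -> 'I_3 -> A).

Definition dot u v := \sum_i u i * v i.

Definition cross u v (i : 'I_3) :=
  if i == 0 then u 1 * v 2 - u 2 * v 1
  else if i == 1 then u 2 * v 0 - u 0 * v 2 else u 0 * v 1 - u 1 * v 0.

Definition parallel u v := forall i j, u i * v j = u j * v i.

(** The rows of the cofactor matrix of [r]; the cyclic order of the pairs absorbs the signs. *)
Definition cofactor_row r (k : 'I_3) :=
  if k == 0 then cross (r 1) (r 2) else if k == 1 then cross (r 2) (r 0) else cross (r 0) (r 1).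

Lemma cross_parallel u v F : dot u F = 0 -> dot v F = 0 -> parallel (cross u v) F.
Proof.
rewrite /dot !sum_ord3 => hu hv.
have e01 : cross u v 0 * F 1 = cross u v 1 * F 0.
  apply/eqP; rewrite -subr_eq0; apply/eqP.
  transitivity (v 2 * (u 0 * F 0 + u 1 * F 1 + u 2 * F 2)
    - u 2 * (v 0 * F 0 + v 1 * F 1 + v 2 * F 2)); last by rewrite hu hv !mulr0 subr0.
  by rewrite /cross /=; ring.
have e02 : cross u v 0 * F 2 = cross u v 2 * F 0.
  apply/eqP; rewrite -subr_eq0; apply/eqP.
  transitivity (u 1 * (v 0 * F 0 + v 1 * F 1 + v 2 * F 2)
    - v 1 * (u 0 * F 0 + u 1 * F 1 + u 2 * F 2)); last by rewrite hu hv !mulr0 subr0.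
  by rewrite /cross /=; ring.
have e12 : cross u v 1 * F 2 = cross u v 2 * F 1.
  apply/eqP; rewrite -subr_eq0; apply/eqP.
  transitivity (v 0 * (u 0 * F 0 + u 1 * F 1 + u 2 * F 2)
    - u 0 * (v 0 * F 0 + v 1 * F 1 + v 2 * F 2)); last by rewrite hu hv !mulr0 subr0.
  by rewrite /cross /=; ring.
by apply: forall_ord3; apply: forall_ord3.
Qed.

(** Cramer's rule: the transposed cofactor matrix times [r] is [D] times the identity, and the
    determinant [D] is 0 because [r] kills the nonzero vector [F]. *)
Lemma cofactor_row_relation r F : (exists i, F i != 0) -> (forall k, dot (r k) F = 0) ->
  forall i j, \sum_k cofactor_row r k i * r k j = 0.
Proof.
move=> [l Fl] hr.
pose D := r 0 0 * cross (r 1) (r 2) 0 + r 0 1 * cross (r 1) (r 2) 1 + r 0 2 * cross (r 1) (r 2) 2.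
have D0 : D = 0.
  have : forall l, D * F l = 0.
    have e i : \sum_k cofactor_row r k i * dot (r k) F = 0.
      by rewrite big1 // => k _; rewrite hr mulr0.
    by apply: forall_ord3; [rewrite -(e 0)|rewrite -(e 1)|rewrite -(e 2)];
      rewrite sum_ord3 /dot !sum_ord3 /D /cofactor_row /cross /=; ring.
  by move=> /(_ l) /eqP; rewrite mulf_eq0 (negPf Fl) orbF => /eqP.
have E : forall i j, \sum_k cofactor_row r k i * r k j = if i == j then D else 0.
  by apply: forall_ord3; apply: forall_ord3;
    rewrite sum_ord3 /D /cofactor_row /cross /=; ring.
by move=> i j; rewrite E D0 if_same.
Qed.

(** Functoriality of the exterior square: the cross product of two combinations of rows expands over
    the pairwise cross products of the rows. *)
Lemma cross_combination r (a b : 'I_3 -> A) u v :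
  (forall i, u i = \sum_k a k * r k i) -> (forall i, v i = \sum_k b k * r k i) ->
  forall i, cross u v i = \sum_k cross a b k * cofactor_row r k i.
Proof.
by move=> hu hv; apply: forall_ord3;
  rewrite sum_ord3 /cofactor_row /cross /= !hu !hv !sum_ord3; ring.
Qed.

Definition koszul F (k : 'I_3) := cross F (fun j => (j == k)%:R).

Lemma koszul_dot F k : dot (koszul F k) F = 0.
Proof.
by move: k; apply: forall_ord3; rewrite /dot sum_ord3 /koszul /cross /=; ring.
Qed.

Lemma koszul_cofactor F k i : cofactor_row (koszul F) k i = F k * F i.
Proof.
by move: k i; apply: forall_ord3; apply: forall_ord3;
  rewrite /cofactor_row /koszul /cross /=; ring.
Qed.

End CrossProduct.

Lemma homog0_mpolyC (K : comNzRingType) n (p : {mpoly K[n]}) :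
  p \is 0.-homog -> p = (p@_0)%:MP.
Proof.
move=> /dhomogP hp; apply/mpolyP => m; rewrite mcoeffC.
have [->|m0] := eqVneq m 0%MM; first by rewrite mulr1.
rewrite mulr0; apply/eqP; rewrite mcoeff_eq0; apply/negP => /hp /= /eqP.
by rewrite mdeg_eq0 (negPf m0).
Qed.

Section Saturation.
Variables (K : numClosedFieldType) (d : nat) (f : {mpoly K[3]}).
Hypotheses (d1 : (1 < d)%N) (f0 : f != 0) (hf : f \is d.-homog) (sqf : squarefree f).

Local Notation F := (fun i => f^`M(i)).

Lemma gradient_neq0 : exists i, f^`M(i) != 0.
Proof.
apply: contrapT => h; move/eqP: f0; apply.
have := euler_identity hf; rewrite big1 => [/esym/eqP|i _].
  by rewrite -scaler_nat scaler_eq0 pnatr_eq0 gtn_eqF ?(ltnW d1) //= => /eqP.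
have [->|fi] := eqVneq (f^`M(i)) 0; first by rewrite mulr0.
by case: h; exists i.
Qed.

(** Contracting [w] with Euler's field gives [wf], and with row 0 of [P] gives [wg]. Parallelism
    relates them by [f * (d%:R * wg) = dir_deriv P f * wf], so f divides [wf] by regularity, and the
    quotient divided by d is [t]. *)
Lemma gradient_saturated (w : 'I_3 -> {mpoly K[3]}) :
  parallel w F -> exists t, forall i, w i = t * f^`M(i).
Proof.
move=> hw; have [P uP fP] := generic_frame f0 hf.
have dn : d%:R != 0 :> K by rewrite pnatr_eq0 gtn_eqF // ltnW.
pose wf := \sum_i 'X_i * w i; pose wg := \sum_i P 0 i *: w i.
have e1 j : wf * f^`M(j) = d%:R * f * w j.
  rewrite mulr_natl -(euler_identity hf) !mulr_suml; apply: eq_bigr => i _.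
  by rewrite -mulrA hw [w j * _]mulrC mulrA.
have e2 : f * (d%:R * wg) = dir_deriv P f * wf.
  rewrite /dir_deriv mulr_suml !mulr_sumr; apply: eq_bigr => j _.
  rewrite -!mul_mpolyC; transitivity ((P 0 j)%:MP * (wf * f^`M(j))); last by ring.
  by rewrite e1; ring.
have [c ec] := regular_sequence uP d1 hf sqf fP e2.
exists (d%:R^-1 *: c) => j.
have dd : (d%:R^-1 : K)%:MP * d%:R = 1 :> {mpoly K[3]}.
  by rewrite -mpolyC_nat -mpolyCM mulVf // mpolyC1.
apply: (mulfI f0); rewrite -mul_mpolyC; transitivity ((d%:R^-1)%:MP * (d%:R * f * w j)).
  by rewrite !mulrA dd mul1r.
by rewrite -e1 ec; ring.
Qed.

End Saturation.

Section Syzygies.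
Variables (K : numClosedFieldType) (d : nat) (f : {mpoly K[3]}).
Hypotheses (d1 : (1 < d)%N) (f0 : f != 0) (hf : f \is d.-homog) (sqf : squarefree f).
Variables (D : 'I_3 -> nat) (r : 'I_3 -> 'rV[{mpoly K[3]}]_3).
Hypotheses (rmin : minimal_generators f r) (rhom : forall j, homogeneous_triple (D j) (r j)).

Local Notation F := (fun i => f^`M(i)).
Local Notation row s := (fun i => s 0 i).

Lemma syzygy_dot k : dot (row (r k)) F = 0.
Proof. by have [h _] := rmin; exact: h. Qed.

Lemma syzygy_generated s : AR f s ->
  exists a : 'I_3 -> {mpoly K[3]}, forall i, s 0 i = \sum_k a k * r k 0 i.
Proof.
have [_ /(_ [set: 'I_3]) [_ /(_ (fun j => finset.in_setT j)) h]] := rmin.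
move=> /h [a ->]; exists a => i; rewrite summxE.
by apply: eq_big => [k|k _]; rewrite ?inE // mxE.
Qed.

Lemma syzygy_irredundant j (a : 'I_3 -> {mpoly K[3]}) :
  ~ forall i, r j 0 i = \sum_(k | k != j) a k * r k 0 i.
Proof.
move=> e; have [_ /(_ [set~ j]) [h _]] := rmin.
have /h /(_ j) : generates_AR f r [set~ j].
  move=> s /syzygy_generated [c ec]; exists (fun k => c k + c j * a k).
  apply/rowP => i; rewrite ec (bigD1 j) //= e summxE mulr_sumr -big_split.
  by apply: eq_big => [k|k _]; rewrite ?inE // mxE mulrDl mulrA addrC.
by rewrite !inE eqxx.
Qed.

Lemma syzygy_neq0 j : ~ forall i, r j 0 i = 0.
Proof.
move=> e; apply: (@syzygy_irredundant j (fun=> 0)) => i.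
by rewrite e big1 // => k _; rewrite mul0r.
Qed.

(** A nonzero constant coefficient could be inverted to eliminate [r j], against minimality. *)
Lemma relation_irredundant (c : 'I_3 -> {mpoly K[3]}) j :
  (forall i, \sum_k c k * r k 0 i = 0) -> c j != 0 -> ~ c j \is 0.-homog.
Proof.
move=> hc cj /homog0_mpolyC; set u := (c j)@_0 => ec.
have u0 : u != 0 by apply: contraNneq cj => u0; rewrite ec u0.
apply: (@syzygy_irredundant j (fun k => - u^-1%:MP * c k)) => i.
have := hc i; rewrite (bigD1 j) //= => /eqP; rewrite addr_eq0 => /eqP e.
have uu : (u^-1)%:MP * c j = 1 by rewrite ec -mpolyCM mulVf.
rewrite -[LHS]mul1r -uu -mulrA e mulrN mulr_sumr -sumrN.
by apply: eq_bigr => k _; rewrite mulNr mulrA mulNr.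
Qed.

Definition hilbert_burch (h : 'I_3 -> {mpoly K[3]}) :=
  forall k i, cofactor_row (fun k => row (r k)) k i = h k * f^`M(i).

Lemma hilbert_burch_exists : exists h, hilbert_burch h.
Proof.
have : forall k, exists t, forall i, cofactor_row (fun k => row (r k)) k i = t * f^`M(i).
  move=> k; apply: (gradient_saturated d1 f0 hf sqf).
  by rewrite /cofactor_row; do 2?case: ifP => _; apply: cross_parallel; exact: syzygy_dot.
by move=> /choice [h hh]; exists h.
Qed.

Variable h : 'I_3 -> {mpoly K[3]}.
Hypothesis hb : hilbert_burch h.

(** Multiplication by a nonzero partial derivative turns the [h k] into cofactors, to which Cramer's
    rule applies. *)
Lemma hilbert_burch_relation i : \sum_k h k * r k 0 i = 0.
Proof.
have [l Fl] := gradient_neq0 d1 f0 hf; apply: (mulfI Fl); rewrite mulr0 mulr_sumr.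
rewrite -[RHS](@cofactor_row_relation _ (fun k => row (r k)) F _ syzygy_dot l i); last by exists l.
by apply: eq_bigr => k _; rewrite hb mulrA [_ * h k]mulrC.
Qed.

(* The cofactor vectors of the three Koszul syzygies are the [f_i * grad f]. *)
Lemma jacobian_in_minors i : ideal_span h (f^`M(i)).
Proof.
have [l Fl] := gradient_neq0 d1 f0 hf.
have hk : forall k, exists a : 'I_3 -> {mpoly K[3]},
    forall j, koszul F k j = \sum_l a l * r l 0 j.
  move=> k; have [|a ha] := @syzygy_generated (\row_j koszul F k j).
    rewrite /AR /=; under eq_bigr => j _ do rewrite mxE.
    exact: koszul_dot.
  by exists a => j; rewrite -ha mxE.
have hc u v (a b : 'I_3 -> {mpoly K[3]}) : (forall i, u i = \sum_k a k * r k 0 i) ->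
    (forall i, v i = \sum_k b k * r k 0 i) -> cross u v l = f^`M(i) * f^`M(l) ->
    ideal_span h (f^`M(i)).
  move=> ha hb' e; exists (cross a b); apply: (mulIf Fl); rewrite -e.
  rewrite (cross_combination ha hb' l) mulr_suml.
  by apply: eq_bigr => k _; rewrite hb mulrA.
have [a0 h0] := hk 0; have [a1 h1] := hk 1; have [a2 h2] := hk 2.
have e := koszul_cofactor F i l; move: i hc e; rewrite /cofactor_row.
by apply: forall_ord3 => hc e; [exact: hc h1 h2 e|exact: hc h2 h0 e|exact: hc h0 h1 e].
Qed.

(** Since the f_i lie in the ideal of the [h k], each product f_i c_j has the form [q i * h j]. Then
    [q] is parallel to the gradient, hence a multiple of it, and the same factor [t] works for
    [c]. *)
Lemma minors_saturated c : parallel c h -> exists t, forall k, c k = t * h k.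
Proof.
move=> hc; have [l Fl] := gradient_neq0 d1 f0 hf.
have /choice [q hq] : forall i, exists q, forall j, q * h j = f^`M(i) * c j.
  move=> i; have [a ->] := jacobian_in_minors i; exists (\sum_k a k * c k) => j.
  by rewrite !mulr_suml; apply: eq_bigr => k _; rewrite -!mulrA hc [h k * _]mulrC.
have [m hm] : exists m, h m != 0.
  apply: contrapT => n; have [a e] := jacobian_in_minors l; move/eqP: Fl; apply.
  rewrite e big1 // => k _; have [->|hk] := eqVneq (h k) 0; first by rewrite mulr0.
  by case: n; exists k.
have [|t ht] := gradient_saturated d1 f0 hf sqf (w := q).
  move=> i j; apply: (mulIf hm).
  by rewrite mulrAC hq [RHS]mulrAC hq; ring.
exists t => k; apply: (mulfI Fl); rewrite -hq ht; ring.
Qed.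

(** The cross product of a row [r k] with [X], the zero combination of the rows, expands into
    multiples of the gradient; comparing them gives [c i * h j = c j * h i]. *)
Lemma relation_multiple c : (forall i, \sum_k c k * r k 0 i = 0) ->
  exists t, forall k, c k = t * h k.
Proof.
move=> hc; apply: minors_saturated; have [l Fl] := gradient_neq0 d1 f0 hf.
pose X i := c 0 * r 0 0 i + c 1 * r 1 0 i + c 2 * r 2 0 i.
have X0 i : X i = 0 by rewrite -(hc i) sum_ord3.
have crossX u i : cross u X i = 0 by rewrite /cross !X0 !mulr0 !subrr !if_same.
have key i j k : c i * cofactor_row (fun k => row (r k)) j l
     - c j * cofactor_row (fun k => row (r k)) i l = cross (row (r k)) X l ->
     c i * h j = c j * h i.
  rewrite !hb crossX !mulrA -mulrBl => /eqP.
  by rewrite mulf_eq0 (negPf Fl) orbF subr_eq0 => /eqP.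
have e01 : c 0 * h 1 = c 1 * h 0.
  apply: (key _ _ 2); rewrite /cofactor_row /=; move: (l).
  by apply: forall_ord3; rewrite /cross /X /=; ring.
have e12 : c 1 * h 2 = c 2 * h 1.
  apply: (key _ _ 0); rewrite /cofactor_row /=; move: (l).
  by apply: forall_ord3; rewrite /cross /X /=; ring.
have e20 : c 2 * h 0 = c 0 * h 2.
  apply: (key _ _ 1); rewrite /cofactor_row /=; move: (l).
  by apply: forall_ord3; rewrite /cross /X /=; ring.
by apply: forall_ord3; apply: forall_ord3.
Qed.

(** As [s] is homogeneous, each coefficient may be replaced by its component of degree [n - D k],
    which does not exist when [n < D k]. *)
Lemma syzygy_low_degree n s : AR f s -> homogeneous_triple n s ->
  exists a : 'I_3 -> {mpoly K[3]},
    (forall i, s 0 i = \sum_k a k * r k 0 i) /\ forall k, (n < D k)%N -> a k = 0.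
Proof.
move=> /syzygy_generated [a ha] hs.
exists (fun k => if (D k <= n)%N then pihomog mdeg (n - D k) (a k) else 0); split=> [i|k].
  rewrite -(pihomog_dE (hs i)) ha raddf_sum; apply: eq_bigr => k _ /=.
  by rewrite mulrC (pihomogMl _ _ (rhom k i)); case: ifP => _; rewrite ?mul0r // mulrC.
by rewrite ltnNge => /negPf ->.
Qed.

Let sigma := (D 0%R + D 1%R + D 2%R)%N.

Lemma minor_homog k i : cofactor_row (fun k => row (r k)) k i \is (sigma - D k).-homog.
Proof.
have hc (j1 j2 : 'I_3) : cross (row (r j1)) (row (r j2)) i \is (D j1 + D j2).-homog.
  have hM a b : r j1 0 a * r j2 0 b \is (D j1 + D j2).-homog.
    by rewrite dhomogM // rhom.
  by rewrite /cross; do 2?case: ifP => _; rewrite rpredB // hM.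
move: k; apply: forall_ord3; rewrite /cofactor_row /=.
- by have -> : (sigma - D 0%R = D 1%R + D 2%R)%N by rewrite /sigma; lia.
- by have -> : (sigma - D 1%R = D 2%R + D 0%R)%N by rewrite /sigma; lia.
- by have -> : (sigma - D 2%R = D 0%R + D 1%R)%N by rewrite /sigma; lia.
Qed.

Lemma hilbert_burch_homog k :
  if (d.-1 <= sigma - D k)%N then h k \is (sigma - D k - d.-1).-homog else h k == 0.
Proof.
have [l Fl] := gradient_neq0 d1 f0 hf.
apply: (homog_factor (mderiv_homog l hf) Fl); rewrite mulrC -hb; exact: minor_homog.
Qed.

(** The inequality is strict because in degree 0 [h k] would be a nonzero constant coefficient in a
    relation between the generators. *)
Lemma hilbert_burch_degree k : h k != 0 ->
  (d.-1 < sigma - D k)%N /\ h k \is (sigma - D k - d.-1).-homog.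
Proof.
move=> hk; have := hilbert_burch_homog k.
case: (leqP d.-1 (sigma - D k)) => [le hh|_ /eqP h0]; last first.
  by rewrite h0 eqxx in hk.
split=> //; rewrite ltn_neqAle le andbT; apply/eqP => e.
rewrite -e subnn in hh.
exact: (relation_irredundant hilbert_burch_relation hk hh).
Qed.

Hypotheses (D01 : (D 0%R <= D 1%R)%N) (D12 : (D 1%R <= D 2%R)%N).

(* Otherwise the first two generators would be multiples of a syzygy of smaller degree. *)
Lemma hilbert_burch_last_neq0 : h 2 != 0.
Proof.
apply/eqP => h20.
have hrel i : h 0 * r 0 0 i + h 1 * r 1 0 i = 0.
  by rewrite -(hilbert_burch_relation i) sum_ord3 h20 mul0r addr0.
(* For each [i] the vector with entries [r 1 0 i], [- r 0 0 i] and 0 is parallel to [h], as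
   [h 2 = 0]. The factors [t i] form the syzygy of smaller degree. *)
have /choice [t ht] : forall i, exists t, r 1 0 i = t * h 0 /\ - r 0 0 i = t * h 1.
  move=> i.
  pose c (k : 'I_3) := if k == 0 then r 1 0 i else if k == 1 then - r 0 0 i else 0.
  have [|t ht] := @minors_saturated c; last by exists t; split; [rewrite -(ht 0)|rewrite -(ht 1)].
  have e01 : c 0 * h 1 = c 1 * h 0.
    by apply/eqP; rewrite /c /= mulNr -addr_eq0 mulrC [r 0 0 i * _]mulrC addrC hrel.
  by apply: forall_ord3; apply: forall_ord3 => //; rewrite ?h20 /c /= ?mul0r ?mulr0.
have h0n : h 0 != 0.
  apply/eqP => h00; apply: (@syzygy_neq0 1) => i; by rewrite (ht i).1 h00 mulr0.
have h1n : h 1 != 0.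
  apply/eqP => h10; apply: (@syzygy_neq0 0) => i.
  by apply/eqP; rewrite -oppr_eq0 (ht i).2 h10 mulr0.
have [lt hh] := hilbert_burch_degree h1n.
set e := (sigma - D 1%R - d.-1)%N in hh.
have e0 : (0 < e)%N by rewrite subn_gt0.
have t0 : ~ forall i, t i = 0.
  by move=> z; apply: (@syzygy_neq0 1) => i; rewrite (ht i).1 z mul0r.
have htd i : if (e <= D 0%R)%N then t i \is (D 0%R - e).-homog else t i == 0.
  by apply: (homog_factor hh h1n); rewrite mulrC -(ht i).2 rpredN rhom.
have [le|lt'] := leqP e (D 0%R); last first.
  by apply: t0 => i; have := htd i; rewrite leqNgt lt' => /eqP.
have [||a [ha az]] := @syzygy_low_degree (D 0%R - e) (\row_i t i).
- rewrite /AR /=; apply: (mulfI h0n); rewrite mulr0 -[RHS](syzygy_dot 1) mulr_sumr.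
  by apply: eq_bigr => i _; rewrite mxE (ht i).1 mulrA [h 0 * _]mulrC.
- by move=> i; rewrite mxE; have := htd i; rewrite le.
apply: t0 => i; have := ha i; rewrite mxE => ->; rewrite big1 // => k _.
rewrite az ?mul0r //; apply: (@leq_trans (D 0%R)); first by lia.
by move: k; apply: forall_ord3 => //; exact: leq_trans D12.
Qed.

Lemma degree_sum_ge : (d <= D 0%R + D 1%R)%N.
Proof.
by have [+ _] := hilbert_burch_degree hilbert_burch_last_neq0; rewrite /sigma; lia.
Qed.

End Syzygies.

(** If [D' 0 < D 0], then [r' 0] would be zero. If [D' 1 < D 1], then [r' 0] and [r' 1] would be
    multiples of [r 0], although their cross product is nonzero because [h' 2] is. If [D' 2 < D 2],
    then all [r' k], hence also [r 2], would be combinations of [r 0] and [r 1]. *)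
Lemma exponents_le (K : numClosedFieldType) (d : nat) (f : {mpoly K[3]})
  (D D' : 'I_3 -> nat) (r r' : 'I_3 -> 'rV[{mpoly K[3]}]_3) :
  (1 < d)%N -> f != 0 -> f \is d.-homog -> squarefree f ->
  minimal_generators f r -> (forall j, homogeneous_triple (D j) (r j)) ->
  minimal_generators f r' -> (forall j, homogeneous_triple (D' j) (r' j)) ->
  (D 0%R <= D 1%R <= D 2%R)%N -> (D' 0%R <= D' 1%R <= D' 2%R)%N ->
  forall j, (D j <= D' j)%N.
Proof.
move=> d1 f0 hf sqf rmin rhom rmin' rhom' /andP[D01 D12] /andP[D01' D12'].
have [h' hb'] := hilbert_burch_exists d1 f0 hf sqf rmin'.
have h2' := hilbert_burch_last_neq0 d1 f0 hf sqf rmin' rhom' hb' D01' D12'.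
have [ar' _] := rmin'.
have [l Fl] := gradient_neq0 d1 f0 hf.
have ncross : cross (fun i => r' 0 0 i) (fun i => r' 1 0 i) l != 0.
  by have := hb' 2 l; rewrite /cofactor_row /= => ->; rewrite mulf_neq0.
have low k := syzygy_low_degree rmin rhom (ar' k) (rhom' k).
have [a0 [e0 z0]] := low 0; have [a1 [e1 z1]] := low 1; have [a2 [e2 z2]] := low 2.
apply: forall_ord3; rewrite leqNgt; apply/negP => lt.
- apply: (@syzygy_neq0 _ _ _ rmin' 0) => i; rewrite e0 big1 // => k _.
  rewrite z0 ?mul0r //; apply: leq_trans lt _.
  by move: k; apply: forall_ord3 => //; exact: leq_trans D12.
- move/eqP: ncross; apply; rewrite /cross.
  have e i : r' 0 0 i = a0 0 * r 0 0 i.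
    by rewrite e0 sum_ord3 (z0 1) ?(z0 2) ?mul0r ?addr0 //; lia.
  have e' i : r' 1 0 i = a1 0 * r 0 0 i.
    by rewrite e1 sum_ord3 (z1 1) ?(z1 2) ?mul0r ?addr0 //; lia.
  by rewrite !e !e'; do 2?case: ifP => _; ring.
- have [ar _] := rmin; have [c ec] := syzygy_generated rmin' (ar 2).
  apply: (@syzygy_irredundant _ _ _ rmin 2 (fun k => c 0 * a0 k + c 1 * a1 k + c 2 * a2 k)) => i.
  have z k : (D' k <= D' 2%R)%N -> (D' k < D 2%R)%N by move=> h; exact: leq_ltn_trans lt.
  rewrite ec sum_ord3 e0 e1 e2 !mulr_sumr -!big_split /=.
  rewrite (bigD1 2) //= z0 ?z1 ?z2 ?z //; last by exact: leq_trans D12'.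
  rewrite !mul0r !mulr0 !addr0 add0r; apply: eq_bigr => k _; ring.
Qed.

(** * Hilbert function of the Jacobian ideal *)

Section TripleMaps.
Variable K : fieldType.

Definition triple a b c := (dhomog 3 K a * dhomog 3 K b * dhomog 3 K c)%type.

Definition triple_coord a b c (u : triple a b c) (i : 'I_3) : {mpoly K[3]} :=
  if i == 0 then mpoly_of_dhomog u.1.1
  else if i == 1 then mpoly_of_dhomog u.1.2 else mpoly_of_dhomog u.2.

(** The projection to degree [n] makes the map linear between fixed spaces for arbitrary [p]; it
    changes nothing when the degrees match, see [triple_map_val]. *)
Definition triple_map a b c n (p : 'I_3 -> {mpoly K[3]}) (u : triple a b c) : dhomog 3 K n :=
  DHomog (pihomogP mdeg n (\sum_i p i * triple_coord u i)).

Lemma triple_coord_linear a b c i x (u v : triple a b c) :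
  triple_coord (x *: u + v) i = x *: triple_coord u i + triple_coord v i.
Proof. by rewrite /triple_coord; do 2?case: ifP => _. Qed.

Lemma triple_map_is_linear a b c n p : linear (@triple_map a b c n p).
Proof.
move=> x u v; apply: val_inj; rewrite /= -linearP /=; congr (pihomog _ _ _).
rewrite scaler_sumr -big_split; apply: eq_bigr => i _.
by rewrite triple_coord_linear mulrDr scalerAr.
Qed.
HB.instance Definition _ a b c n p := GRing.isLinear.Build K (triple a b c) (dhomog 3 K n) _
  (@triple_map a b c n p) (@triple_map_is_linear a b c n p).

Definition triple_map3 a b c n (M : 'I_3 -> 'I_3 -> {mpoly K[3]}) (u : triple a b c) : triple n n n :=
  (triple_map n (M 0) u, triple_map n (M 1) u, triple_map n (M 2) u).

Lemma triple_map3_is_linear a b c n M : linear (@triple_map3 a b c n M).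
Proof. by move=> x u v; rewrite /triple_map3 !linearP. Qed.
HB.instance Definition _ a b c n M := GRing.isLinear.Build K (triple a b c) (triple n n n) _
  (@triple_map3 a b c n M) (@triple_map3_is_linear a b c n M).

Definition homog_mul n a (p : {mpoly K[3]}) (t : dhomog 3 K n) : dhomog 3 K a :=
  DHomog (pihomogP mdeg a (p * t)).

Lemma homog_mul_is_linear n a p : linear (@homog_mul n a p).
Proof.
by move=> x u v; apply: val_inj => /=; rewrite mulrDr -scalerAr linearP.
Qed.
HB.instance Definition _ n a p := GRing.isLinear.Build K (dhomog 3 K n) (dhomog 3 K a) _
  (@homog_mul n a p) (@homog_mul_is_linear n a p).

Definition diag_map n a b c (p : 'I_3 -> {mpoly K[3]}) (t : dhomog 3 K n) : triple a b c :=
  (homog_mul a (p 0) t, homog_mul b (p 1) t, homog_mul c (p 2) t).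

Lemma diag_map_is_linear n a b c p : linear (@diag_map n a b c p).
Proof. by move=> x u v; rewrite /diag_map !linearP. Qed.
HB.instance Definition _ n a b c p := GRing.isLinear.Build K (dhomog 3 K n) (triple a b c) _
  (@diag_map n a b c p) (@diag_map_is_linear n a b c p).

Lemma dim_dhomog n : \dim {:dhomog 3 K n} = 'C(n + 2, n).
Proof. by rewrite dimvf. Qed.

Lemma dim_triple a b c : \dim {:triple a b c} = ('C(a + 2, a) + 'C(b + 2, b) + 'C(c + 2, c))%N.
Proof. by rewrite dimvf. Qed.

Lemma triple_map_val a b c n p (u : triple a b c) :
  (forall i, p i * triple_coord u i \is n.-homog) ->
  val (triple_map n p u) = \sum_i p i * triple_coord u i.
Proof. by move=> hp; rewrite /= pihomog_dE //; apply: rpred_sum => i _; exact: hp. Qed.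

Lemma triple_coord_homog a b c (u : triple a b c) (w : 'I_3 -> nat) i :
  w 0 = a -> w 1 = b -> w 2 = c -> triple_coord u i \is (w i).-homog.
Proof.
move=> ea eb ec; subst a b c; move: i.
by apply: forall_ord3; [apply: (valP u.1.1)|apply: (valP u.1.2)|apply: (valP u.2)].
Qed.

Lemma triple_coord_inj a b c (u v : triple a b c) :
  (forall i, triple_coord u i = triple_coord v i) -> u = v.
Proof.
case: u => [[u0 u1] u2]; case: v => [[v0 v1] v2] e.
by congr (_, _, _); apply: val_inj; [exact: (e 0)|exact: (e 1)|exact: (e 2)].
Qed.

Definition jacobian_piece (f : {mpoly K[3]}) m n : {vspace dhomog 3 K n} :=
  limg (linfun (@triple_map (n - m) (n - m) (n - m) n (fun i => f^`M(i)))).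

Lemma mem_jacobian_piece f m n (x : dhomog 3 K n) :
  (forall i, f^`M(i) \is m.-homog) -> (m <= n)%N ->
  (x \in jacobian_piece f m n <-> jacobian_ideal f x).
Proof.
move=> hF mn; split.
  move=> /memv_imgP [u _ ->]; rewrite lfunE; exists (triple_coord u).
  rewrite [LHS]triple_map_val; first by apply: eq_bigr => i _; rewrite mulrC.
  move=> i; have := dhomogM (hF i) (@triple_coord_homog _ _ _ u (fun=> (n - m)%N) i erefl erefl erefl).
  by rewrite subnKC.
move=> [a e]; apply/memv_imgP.
pose c i := DHomog (pihomogP mdeg (n - m) (a i)).
exists (c 0, c 1, c 2); rewrite ?memvf // lfunE; apply: val_inj => /=.
rewrite -(pihomog_dE (dhomog_is_dhomog x)) /= e !raddf_sum; apply: eq_bigr => i _ /=.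
rewrite mulrC !(pihomogMl _ _ (hF i)) mn; congr (_ * _).
have -> : triple_coord (c 0, c 1, c 2) i = c i by move: (i); apply: forall_ord3.
by rewrite pihomog_id.
Qed.

End TripleMaps.

Section HilbertFunction.
Variables (K : numClosedFieldType) (d : nat) (f : {mpoly K[3]}).
Hypotheses (d1 : (1 < d)%N) (f0 : f != 0) (hf : f \is d.-homog) (sqf : squarefree f).
Variables (D : 'I_3 -> nat) (r : 'I_3 -> 'rV[{mpoly K[3]}]_3).
Hypotheses (rmin : minimal_generators f r) (rhom : forall j, homogeneous_triple (D j) (r j)).
Hypotheses (D01 : (D 0%R <= D 1%R)%N) (D12 : (D 1%R <= D 2%R)%N).

Let s n := 'C(n + 2, n).
Let e := (D 0%R + D 1%R + D 2%R - d.-1)%N.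

(** Rank-nullity for the maps of the resolution: [Phi] by the gradient, [Psi] by the generators,
    [Theta] by [h]. Exactness comes from generation, [relation_multiple] and [h 2 != 0]. Terms are
    moved across the equation to avoid truncated subtraction of dimensions. *)
Lemma dim_jacobian_piece k : (forall j, (D j <= k)%N) -> (e <= k)%N ->
  (\dim (jacobian_piece f d.-1 (k + d.-1)) + (s (k - D 0%R) + s (k - D 1%R) + s (k - D 2%R))
   = s k + s k + s k + s (k - e))%N.
Proof.
move=> Dk ek; have [h hb] := hilbert_burch_exists d1 f0 hf sqf rmin.
have h2 := hilbert_burch_last_neq0 d1 f0 hf sqf rmin rhom hb D01 D12.
have hF i : f^`M(i) \is d.-1.-homog := mderiv_homog i hf.
pose Phi := linfun (@triple_map K k k k (k + d.-1) (fun i => f^`M(i))).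
have -> : \dim (jacobian_piece f d.-1 (k + d.-1)) = \dim (limg Phi).
  by rewrite /jacobian_piece addnK.
pose Psi := linfun (@triple_map3 K (k - D 0) (k - D 1) (k - D 2) k (fun i j => r j 0 i)).
pose Theta := linfun (@diag_map K (k - e) (k - D 0) (k - D 1) (k - D 2) h).
have PhiE u : val (Phi u) = \sum_i f^`M(i) * triple_coord u i.
  rewrite lfunE [LHS]triple_map_val // => i.
  rewrite addnC.
  exact: (dhomogM (hF i) (@triple_coord_homog _ _ _ _ u (fun=> k) i erefl erefl erefl)).
have PsiE u i : triple_coord (Psi u) i = \sum_j triple_coord u j * r j 0 i.
  have E : forall i, triple_coord (Psi u) i = triple_map k (fun j => r j 0 i) u.
    by rewrite lfunE; apply: forall_ord3.
  rewrite E [LHS]triple_map_val; first by apply: eq_bigr => j _; rewrite mulrC.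
  move=> j; have := dhomogM (rhom j i)
    (@triple_coord_homog _ _ _ _ u (fun j => (k - D j)%N) j erefl erefl erefl).
  by rewrite subnKC.
(* The bound [D j <= e] is available only for nonzero [h j]; otherwise component [j] of [Theta] is 0
   whatever the degrees. *)
have hbd j : h j != 0 -> (D j <= e)%N /\ h j \is (e - D j).-homog.
  move=> hj; have [lt] := hilbert_burch_degree d1 f0 hf rmin rhom hb hj.
  by rewrite subnAC -/e; split=> //; rewrite /e; lia.
have ThetaE t j : triple_coord (Theta t) j = h j * t.
  have -> : triple_coord (Theta t) j = pihomog mdeg (k - D j) (h j * t).
    by rewrite lfunE; move: j; apply: forall_ord3.
  have [->|/hbd [De hj]] := eqVneq (h j) 0; first by rewrite mul0r raddf0.
  rewrite pihomog_dE //; have -> : (k - D j = e - D j + (k - e))%N by lia.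
  exact: (dhomogM hj (dhomog_is_dhomog t)).
have ker1 : lker Phi = limg Psi.
  apply/vspaceP => u; apply/idP/idP.
    rewrite memv_ker => /eqP Phiu.
    have [|a ea] := syzygy_generated rmin (s := \row_i triple_coord u i).
      rewrite /AR /= -[RHS](congr1 val Phiu) PhiE; apply: eq_bigr => i _.
      by rewrite mxE mulrC.
    apply/memv_imgP; pose c j := DHomog (pihomogP mdeg (k - D j) (a j)).
    exists (c 0, c 1, c 2); rewrite ?memvf //; apply: triple_coord_inj => i.
    have hu : triple_coord u i \is k.-homog by exact: (@triple_coord_homog _ _ _ _ _ (fun=> k)).
    have := ea i; rewrite mxE -{1}(pihomog_dE hu) PsiE => ui.
    rewrite -(pihomog_dE hu); have -> : triple_coord u i = \sum_k0 a k0 * r k0 0 i.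
      by rewrite -ea mxE.
    rewrite raddf_sum; apply: eq_bigr => j _ /=; rewrite mulrC (pihomogMl _ _ (rhom j i)) Dk mulrC.
    by congr (_ * _); move: (j); apply: forall_ord3.
  move=> /memv_imgP [c _ ->]; rewrite memv_ker; apply/eqP/val_inj; rewrite PhiE /=.
  under eq_bigr => i _ do rewrite PsiE mulr_sumr.
  rewrite exchange_big big1 // => j _.
  transitivity (triple_coord c j * dot (fun i => r j 0 i) (fun i => f^`M(i))); last first.
    by rewrite (syzygy_dot rmin) mulr0.
  by rewrite mulr_sumr; apply: eq_bigr => i _; ring.
have ker2 : lker Psi = limg Theta.
  apply/vspaceP => c; apply/idP/idP.
    rewrite memv_ker => /eqP Psic.
    have [|t et] := relation_multiple d1 f0 hf sqf rmin hb (c := triple_coord c).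
      by move=> i; rewrite -PsiE Psic; move: i; apply: forall_ord3.
    apply/memv_imgP; exists (DHomog (pihomogP mdeg (k - e) t)); rewrite ?memvf //.
    apply: triple_coord_inj => j; rewrite ThetaE /=.
    have hc : triple_coord c j \is (k - D j).-homog.
      exact: (@triple_coord_homog _ _ _ _ _ (fun j => (k - D j)%N)).
    rewrite -(pihomog_dE hc) et.
    have [->|/hbd [De hj]] := eqVneq (h j) 0; first by rewrite mulr0 mul0r raddf0.
    rewrite mulrC (pihomogMl _ _ hj); have -> : (e - D j <= k - D j)%N by lia.
    by congr (_ * pihomog _ _ _); lia.
  move=> /memv_imgP [t _ ->]; rewrite memv_ker; apply/eqP/triple_coord_inj => i.
  rewrite PsiE; under eq_bigr => j _ do rewrite ThetaE mulrAC.
  rewrite -mulr_suml (hilbert_burch_relation d1 f0 hf rmin hb) mul0r.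
  by move: i; apply: forall_ord3.
have ker3 : lker Theta = 0%VS.
  apply/vspaceP => t; rewrite memv_ker memv0; apply/eqP/eqP => [e0|->]; last by rewrite linear0.
  apply: val_inj; apply: (mulfI h2); rewrite -(ThetaE t 2) e0 mulr0.
  by rewrite /triple_coord.
have := limg_ker_dim Phi fullv; have := limg_ker_dim Psi fullv; have := limg_ker_dim Theta fullv.
rewrite !capfv ker1 ker2 ker3 dimv0 !dim_triple !dim_dhomog /s; lia.
Qed.

End HilbertFunction.

(** * Linear algebra of quotients *)

Section Subspaces.
Variables (K : fieldType) (V : vectType K).

(** [W] is a mere predicate; the space is a subspace of maximal dimension inside it, which any
    further element of [W] would enlarge. *)
Lemma subspace_of_pred (W : V -> Prop) :
  W 0 -> (forall a u v, W u -> W v -> W (a *: u + v)) ->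
  exists U : {vspace V}, forall x, x \in U <-> W x.
Proof.
move=> W0 WD.
pose Q k := `[< exists U : {vspace V}, \dim U = k /\ forall x, x \in U -> W x >].
have exQ : exists k, Q k.
  exists 0%N; apply/asboolP; exists 0%VS; rewrite dimv0; split=> // x.
  by rewrite memv0 => /eqP ->.
have leQ k : Q k -> (k <= \dim {:V})%N.
  by move=> /asboolP [U [<- _]]; apply: dimvS; exact: subvf.
case: (ex_maxnP exQ leQ) => k /asboolP [U [dU WU]] kmax.
exists U => x; split; first exact: WU.
move=> Wx; apply/negPn/negP => xU.
have /kmax : Q (\dim (U + <[x]>)).
  apply/asboolP; exists (U + <[x]>)%VS; split=> // y /memv_addP [u uU [w /vlineP [a ->] ->]].
  by rewrite addrC; apply: WD => //; exact: WU.
rewrite leqNgt -dU => /negP; apply; rewrite ltn_neqAle dimvS ?addvSl // andbT.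
apply/eqP => e; have : (U == U + <[x]>)%VS by rewrite eqEdim addvSl e leqnn.
move=> /eqP eU; move/negP: xU; apply; rewrite eU.
exact: (subvP (addvSr _ _) _ (memv_line x)).
Qed.

Lemma memv_bigcap (I : eqType) (s : seq I) (U : I -> {vspace V}) x :
  x \in (\bigcap_(i <- s) U i)%VS <-> forall i, i \in s -> x \in U i.
Proof.
elim: s => [|i s IH]; first by rewrite big_nil memvf.
rewrite big_cons memv_cap; split.
  by move=> /andP[xi /IH h] j; rewrite inE => /orP[/eqP ->//|/h].
move=> h; rewrite h ?mem_head //=; apply/IH => j js; apply: h.
by rewrite inE js orbT.
Qed.

(** The hypothesis says that V maps onto the product of the V/U_i, as in the Chinese remainder
    theorem; so codimensions add up under intersection. *)
Lemma dim_bigcap_independent (I : eqType) (s : seq I) (U : I -> {vspace V}) : uniq s ->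
  (forall i x, i \in s -> exists y, y - x \in U i /\ forall j, j \in s -> j != i -> y \in U j) ->
  (\dim {:V} = \dim (\bigcap_(i <- s) U i)%VS + \sum_(i <- s) (\dim {:V} - \dim (U i)))%N.
Proof.
elim: s => [|i s IH] /=; first by rewrite !big_nil addn0.
move=> /andP[nis us] h; rewrite !big_cons; set W := (\bigcap_(j <- s) U j)%VS in IH *.
have e1 : (\dim {:V} = \dim W + \sum_(i <- s) (\dim {:V} - \dim (U i)))%N.
  apply: IH => // j x js; have [|y [yj hy]] := h j x; first by rewrite inE js orbT.
  by exists y; split=> // k ks; apply: hy; rewrite inE ks orbT.
have e2 : (U i + W)%VS = fullv.
  apply/vspaceP => x; rewrite memvf.
  have [|y [yi hy]] := h i x; first exact: mem_head.
  rewrite -[x](subrK y) memv_add //; first by rewrite -opprB memvN.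
  apply/memv_bigcap => j js; apply: hy; first by rewrite inE js orbT.
  by apply: contraNneq nis => <-.
have := dimv_sum_cap (U i) W; rewrite e2.
have := dimvS (subvf (U i)); lia.
Qed.

End Subspaces.

Section QuotientDimension.
Variables (K : fieldType) (n : nat) (V : vectType K).
Local Notation L := {fraction {mpoly K[n]}}.
Local Notation "x %:F" := (tofrac x) : ring_scope.
Variables (O I : set L) (pi : V -> L) (U : {vspace V}).
Hypotheses (ID : forall x y, I x -> I y -> I (x + y)) (I0 : I 0).
Hypothesis IZ : forall c x, I x -> I ((c%:MP)%:F * x).
Hypotheses (piD : {morph pi : x y / x + y}) (piZ : forall c x, pi (c *: x) = (c%:MP)%:F * pi x).
Hypotheses (piO : forall x, O (pi x)) (piU : forall x, x \in U <-> I (pi x)).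
Hypothesis pi_surj : forall u, O u -> exists x, I (u - pi x).

Let piN x : pi (- x) = - pi x.
Proof. by rewrite -scaleN1r piZ mpolyCN mpolyC1 rmorphN rmorph1 mulN1r. Qed.

Let pi0 : pi 0 = 0.
Proof. by rewrite -(scale0r 0) piZ mpolyC0 rmorph0 mul0r. Qed.

Let pi_sum N (c : 'I_N -> K) (x : 'I_N -> V) :
  pi (\sum_j c j *: x j) = \sum_j ((c j)%:MP)%:F * pi (x j).
Proof.
by rewrite (big_morph pi piD pi0); apply: eq_bigr => j _; rewrite piZ.
Qed.

Let IN x : I x -> I (- x).
Proof. by move=> /(IZ (-1)); rewrite mpolyCN mpolyC1 rmorphN rmorph1 mulN1r. Qed.

Let IB x y : I x -> I y -> I (x - y).
Proof. by move=> hx hy; apply: ID => //; exact: IN. Qed.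

(** [pi] induces an isomorphism from V/U to O/I, so a basis of a complement of [U] maps to a basis
    of the quotient. *)
Lemma has_quotient_dim_compl : has_quotient_dim O I (\dim U^C).
Proof.
set b := vbasis U^C.
exists (fun j => pi (b`_j)); split=> // u /pi_surj [x hx].
have /memv_addP [y yU [z zC exyz]] : x \in (U + U^C)%VS by rewrite addv_complf memvf.
exists (\row_j coord b j z); split.
  under eq_bigr => j _ do rewrite mxE.
  rewrite -(pi_sum (fun j => coord b j z)) -(coord_vbasis zC).
  have -> : u - pi z = u - pi x + pi y by rewrite exyz piD; ring.
  by apply: ID => //; apply/piU.
move=> c hc; apply/rowP => j; rewrite mxE.
pose w := \sum_k c 0 k *: b`_k.
have wC : w \in U^C%VS.
  by apply: memv_suml => k _; rewrite memvZ // vbasis_mem // mem_nth // size_tuple.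
suff -> : z = w.
  rewrite /w linear_sum /= (bigD1 j) //= linearZ /= coord_free ?(basis_free (vbasisP _)) //.
  rewrite eqxx mulr1 big1 ?addr0 // => k kj.
  by rewrite linearZ /= coord_free ?(basis_free (vbasisP _)) // (negPf kj) mulr0.
apply/eqP; rewrite -subr_eq0 -memv0 -(capv_compl U) memv_cap.
apply/andP; split; last exact: rpredB.
apply/piU; rewrite piD piN.
have -> : pi z - pi w = (u - pi w) - (u - pi x) - pi y by rewrite exyz piD; ring.
apply: IB; last exact/piU; apply: IB => //.
by rewrite /w pi_sum.
Qed.

(** A basis of the quotient lifts along [pi] to a basis of a complement of [U]. Uniqueness
    determines the value that [xget] selects in [tjurina]. *)
Lemma has_quotient_dim_unique N : has_quotient_dim O I N -> N = \dim U^C.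
Proof.
move=> [e [eO he]].
have /choice [x hx] : forall j, exists x, I (e j - pi x) by move=> j; exact: pi_surj.
pose g (c : 'rV[K]_N) := \sum_j c 0 j *: x j.
have glin : linear g.
  move=> a c c'; rewrite /g scaler_sumr -big_split; apply: eq_bigr => j _.
  by rewrite !mxE scalerDl scalerA.
pose gl : {linear 'rV[K]_N -> V} := HB.pack g (GRing.isLinear.Build K 'rV[K]_N V _ g glin).
pose G := linfun gl.
have GE c : G c = g c by rewrite lfunE.
have Gpi (c : 'rV[K]_N) : I (\sum_j ((c 0 j)%:MP)%:F * e j - pi (G c)).
  rewrite GE pi_sum -sumrB; elim/big_ind: _ => // j _.
  by rewrite -mulrBr; exact: IZ.
have kerU (c : 'rV[K]_N) : G c \in U -> c = 0.
  (* [O 0] is obtained by transport from [O (pi 0)]. Both [c] and 0 then represent 0 in the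
     quotient, so they coincide. *)
  move=> /piU h; have [c0 [_ uc]] := he 0 (let: O0 := piO 0 in eq_ind _ O O0 _ pi0).
  have zero : forall j, ((0 : 'rV[K]_N) 0 j) = 0 by move=> j; rewrite mxE.
  rewrite -(uc c) ?(uc 0) //.
    rewrite big1 ?subrr // => j _; by rewrite mxE mpolyC0 rmorph0 mul0r.
  rewrite sub0r; apply: IN; rewrite -[X in I X](subrK (pi (G c))); exact: ID.
have dG : \dim (limg G) = N.
  rewrite limg_dim_eq; first by rewrite dimvf /dim /= mul1n.
  apply/eqP; rewrite capfv -subv0; apply/subvP => c; rewrite memv_ker => /eqP Gc.
  by rewrite memv0; apply/eqP/kerU; rewrite Gc mem0v.
have cap0 : (limg G :&: U)%VS = 0%VS.
  apply/eqP; rewrite -subv0; apply/subvP => y; rewrite memv_cap => /andP[/memv_imgP [c _ ->] /kerU ->].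
  by rewrite linear0 mem0v.
have full : (limg G + U)%VS = fullv.
  apply/vspaceP => y; rewrite memvf.
  have [c [hc _]] := he (pi y) (piO y).
  rewrite -[y](subrK (G c)) addrC memv_add ?memv_img ?memvf //.
  apply/piU; rewrite piD piN.
  have -> : pi y - pi (G c) = (pi y - \sum_j ((c 0 j)%:MP)%:F * e j)
      + (\sum_j ((c 0 j)%:MP)%:F * e j - pi (G c)) by rewrite addrA subrK.
  exact: ID.
have := dimv_disjoint_sum cap0; rewrite full dG dimv_compl => ->; by rewrite addnK.
Qed.

End QuotientDimension.

(** * The affine plane l = 1 *)

Section Nullstellensatz.
Variables (K : closedFieldType) (n : nat).
Implicit Types (a : {mpoly K[n]} -> Prop).

Definition eval_var (p : {poly K}) (i : 'I_n) : {mpoly K[n]} := (map_poly (@mpolyC n K) p).['X_i].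

Lemma eval_varM p q i : eval_var (p * q) i = eval_var p i * eval_var q i.
Proof. by rewrite /eval_var rmorphM hornerM. Qed.

Lemma eval_var_linear z i : eval_var ('X - z%:P) i = 'X_i - z%:MP.
Proof. by rewrite /eval_var rmorphB /= map_polyX map_polyC hornerXsubC. Qed.

Lemma eval_var_meval p i v : (eval_var p i).@[v] = p.[v i].
Proof.
elim/poly_ind: p => [|p c IH]; first by rewrite /eval_var rmorph0 !horner0 meval0.
rewrite /eval_var rmorphD rmorphM /= map_polyX map_polyC !hornerE /= -/(eval_var p i).
by rewrite mevalD mevalM IH mevalXU mevalC.
Qed.

(** If every ['X_i - z%:MP] were invertible modulo [a], the linear factors of [p] could be cancelled
    one by one, leaving 1 in [a]. *)
Lemma maximal_step a i p : is_ideal a -> ~ a 1 -> p != 0 -> a (eval_var p i) ->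
  exists z, ~ add_principal a ('X_i - z%:MP) 1.
Proof.
move=> ha na p0 hp; apply: contrapT => h; apply: na.
have {}h z : add_principal a ('X_i - z%:MP) 1.
  by apply: contrapT => nz; apply: h; exists z.
have [r rE] := closed_field_poly_normal p.
suff H : forall s y, a (y * eval_var (\prod_(z <- s) ('X - z%:P)) i) -> a y.
  apply: (H r); have lc : lead_coef p != 0 by rewrite lead_coef_eq0.
  have e : eval_var p i = (lead_coef p)%:MP * eval_var (\prod_(z <- r) ('X - z%:P)) i.
    by rewrite {1}rE -mul_polyC eval_varM {1}/eval_var map_polyC hornerC.
  have -> : 1 * eval_var (\prod_(z <- r) ('X - z%:P)) i = ((lead_coef p)^-1)%:MP * eval_var p i.
    by rewrite e mulrA -mpolyCM mulVf // mpolyC1.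
  exact: (idealM ha).
elim=> [|z s IH] y; first by rewrite big_nil /eval_var rmorph1 hornerC mulr1.
rewrite big_cons eval_varM eval_var_linear mulrA => /IH hy.
have [j [b [hj e]]] := h z; rewrite -[y]mulr1 e mulrDr; apply: (idealD ha).
  exact: (idealM ha).
have -> : y * (b * ('X_i - z%:MP)) = b * (y * ('X_i - z%:MP)) by ring.
exact: (idealM ha).
Qed.

(** Each variable is algebraic modulo [a], so [maximal_step] adjoins a linear polynomial in one
    variable after another and keeps the ideal proper. The final ideal contains every X_i - v_i,
    hence g - g(v) for every g. *)
Lemma cofinite_nullstellensatz a : is_ideal a -> ~ a 1 ->
  (forall i, exists2 p, p != 0 & a (eval_var p i)) ->
  exists v, forall g, a g -> g.@[v] = 0.
Proof.
move=> ha na hp.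
have [b [hb nb sub hv]] : exists b, [/\ is_ideal b, ~ b 1, (forall g, a g -> b g) &
    forall i, exists z, b ('X_i - z%:MP)].
  suff H : forall s : seq 'I_n, exists b, [/\ is_ideal b, ~ b 1, (forall g, a g -> b g) &
      forall i, i \in s -> exists z, b ('X_i - z%:MP)].
    have [b [hb nb sub hv]] := H (enum 'I_n); exists b; split=> // i.
    by apply: hv; rewrite mem_enum.
  elim=> [|i s [b [hb nb sub hv]]]; first by exists a.
  have [p p0 /sub hp'] := hp i; have [z nz] := maximal_step hb nb p0 hp'.
  exists (add_principal b ('X_i - z%:MP)); split=> //.
  - exact: add_principal_ideal.
  - by move=> g /sub; exact: add_principal_sub.
  - move=> j; rewrite inE => /orP[/eqP ->|/hv [w hw]].
      by exists z; exact: add_principal_gen.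
    by exists w; exact: add_principal_sub.
have /choice [v hv'] := hv; exists v => g /sub bg; apply/eqP/negPn/negP => gv.
apply: nb; have vg : (g.@[v])%:MP = mmap (@mpolyC n K) (fun i => (v i)%:MP) g.
  rewrite mevalE raddf_sum; apply: eq_bigr => m _ /=.
  by rewrite mpolyCM rmorph_prod; congr (_ * _); apply: eq_bigr => i _; rewrite rmorphXn.
have bv : b (g.@[v])%:MP.
  rewrite vg; apply: (ideal_congr hb _ bg); rewrite -[X in _ - X]mmap_mpolyX.
  apply: ideal_mmap => [|i]; first exact: hb.
  exact: (idealBC hb).
have -> : 1 = ((g.@[v])^-1)%:MP * (g.@[v])%:MP :> {mpoly K[n]} by rewrite -mpolyCM mulVf // mpolyC1.
exact: (idealM hb).
Qed.

End Nullstellensatz.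

(** * Forms of large degree and the plane l = 1 *)

Section GenericLine.
Variables (K : numClosedFieldType) (f l : {mpoly K[3]}) (m k0 N : nat).
Hypotheses (hF : forall i, f^`M(i) \is m.-homog) (hl : l \is 1.-homog) (l0 : l != 0).
Local Notation J := (jacobian_ideal f).
Hypothesis hline : forall k F, (k0 <= k)%N -> F \is k.-homog -> add_principal J l F.
Hypothesis mk0 : (m <= k0)%N.
Hypothesis hdim : forall k, (k0 <= k)%N ->
  (\dim {:dhomog 3 K k} = \dim (jacobian_piece f m k) + N)%N.

Let hJ : is_ideal J := jacobian_ideal_ideal f.

Lemma jacobian_ideal_pihomog k x : J x -> J (pihomog mdeg k x).
Proof.
move=> [a ->]; rewrite raddf_sum; apply: (ideal_sum _ hJ) => i _ /=.
rewrite mulrC (pihomogMl _ _ (hF i)); case: ifP => _; last exact: (ideal0 hJ).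
by rewrite mulrC; apply: (idealM hJ); exact: ideal_span_gen.
Qed.

Lemma line_reduction k F : (k0 <= k.+1)%N -> F \is k.+1.-homog ->
  exists2 G, G \is k.-homog & J (F - l * G).
Proof.
move=> kk hFk; have [j [b [hj e]]] := hline kk hFk.
exists (pihomog mdeg k b); first exact: pihomogP.
have -> : F - l * pihomog mdeg k b = pihomog mdeg k.+1 j.
  have := pihomogMl k.+1 b hl; rewrite ltn0Sn subSS subn0 => <-.
  by rewrite -{1}(pihomog_dE hFk) e mulrC -raddfB /= addrK.
exact: jacobian_ideal_pihomog.
Qed.

(** By [line_reduction], multiplication by l maps S_k/J_k onto S_(k+1)/J_(k+1); both have dimension
    [N], so it is injective. *)
Lemma line_cancel k F : (k0 <= k)%N -> F \is k.-homog -> J (l * F) -> J F.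
Proof.
move=> kk hFk hlF.
pose L := linfun (@homog_mul K k k.+1 l).
have LE u : val (L u) = l * val u.
  by rewrite lfunE /= pihomog_dE //; exact: (dhomogM hl (dhomog_is_dhomog u)).
have mk : (m <= k)%N by exact: leq_trans kk.
have kerL : lker L = 0%VS.
  apply/eqP; rewrite -subv0; apply/subvP => u; rewrite memv_ker memv0 => /eqP Lu.
  by apply/eqP/val_inj/(mulfI l0); rewrite -LE Lu mulr0.
set J1 := jacobian_piece f m k.+1; set J0 := jacobian_piece f m k.
have full : (limg L + J1)%VS = fullv.
  apply/vspaceP => x; rewrite memvf.
  have [G hG hx] := line_reduction (leqW kk) (dhomog_is_dhomog x).
  rewrite -[x](subrK (L (DHomog hG))) addrC memv_add ?memv_img ?memvf //.
  apply/mem_jacobian_piece => //; first exact: leqW.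
  suff -> : val (x - L (DHomog hG)) = val x - l * G by [].
  by rewrite raddfB -(LE (DHomog hG)).
have sub : (J0 <= L @^-1: J1)%VS.
  apply/subvP => x; rewrite -memv_preim => /mem_jacobian_piece hx.
  apply/mem_jacobian_piece => //; first exact: leqW.
  by rewrite LE; apply: (idealM hJ); exact: hx.
have : J0 == (L @^-1: J1)%VS.
  rewrite eqEdim sub -(@limg_dim_eq _ _ _ L); last by rewrite kerL capv0.
  rewrite -lpreim_cap_limg lpreimK ?capvSr //.
  have := dimv_sum_cap J1 (limg L); rewrite addvC full.
  have := hdim kk; have := hdim (leqW kk); rewrite -/J0 -/J1.
  have -> : \dim (limg L) = \dim {:dhomog 3 K k} by rewrite limg_dim_eq // kerL capv0.
  rewrite !dim_dhomog andTb => h1 h2; rewrite h2 h1.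
  by move: (\dim (J1 :&: limg L)) (\dim J1) (\dim J0) => x y z; lia.
move=> /eqP e; have := @mem_jacobian_piece _ f m k (DHomog hFk) hF mk; rewrite -/J0 e -memv_preim.
case=> + _; apply; apply/mem_jacobian_piece => //; first exact: leqW.
by rewrite -[mpoly_of_dhomog _]/(val _) LE.
Qed.

Definition affine_ideal := add_principal J (l - 1).
Local Notation I := affine_ideal.

Lemma affine_ideal_ideal : is_ideal I.
Proof. exact: (add_principal_ideal _ hJ). Qed.
Let hI := affine_ideal_ideal.

Lemma affine_ideal_sub g : J g -> I g.
Proof. exact: add_principal_sub. Qed.

Lemma affine_ideal_lX k : I (l ^+ k - 1).
Proof.
rewrite -[X in _ - X](expr1n _ k); apply: (ideal_congrX _ hI).
exact: (add_principal_gen _ hJ).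
Qed.

(** Modulo [l - 1] a power of l raises a component of low degree to degree [k], and [line_reduction]
    brings one of high degree down step by step. *)
Lemma affine_ideal_homog g k : (k0 <= k)%N -> exists2 F, F \is k.-homog & I (g - F).
Proof.
move=> kk.
suff H : forall j G, G \is j.-homog -> exists2 F, F \is k.-homog & I (G - F).
  rewrite [g](@pihomog_partitionE _ _ mdeg (msize g)) //.
  elim/big_ind: _ => [|x y [F hFk hx] [G hG hy]|j _].
  - by exists 0; rewrite ?rpred0 // subrr; exact: (ideal0 hI).
  - exists (F + G); first by rewrite rpredD.
    by rewrite opprD addrACA; exact: (idealD hI).
  - by apply: H; exact: pihomogP.
move=> j G hG; have [jk|kj] := leqP j k.
  exists (l ^+ (k - j) * G).
    by have := dhomogM (linear_form_expn hl (k - j)) hG; rewrite subnK.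
  have -> : G - l ^+ (k - j) * G = - G * (l ^+ (k - j) - 1) by ring.
  by apply: (idealM hI); exact: affine_ideal_lX.
rewrite -(subnKC (ltnW kj)) in hG; elim: (j - k)%N G hG => [|i IH] G hG.
  by rewrite addn0 in hG; exists G; rewrite // subrr; exact: (ideal0 hI).
rewrite addnS in hG; have [|G1 /IH [F hFk h1] h2] := line_reduction _ hG.
  by apply: leqW; apply: leq_trans kk _; exact: leq_addr.
exists F => //; apply: (ideal_trans (y := G1) hI) => //.
have -> : G - G1 = (G - l * G1) + G1 * (l - 1) by ring.
apply: (idealD hI); first exact: affine_ideal_sub.
by apply: (idealM hI); exact: (add_principal_gen _ hJ).
Qed.

(* Writing F = j + b (l - 1), the homogeneous components of b lie in J below degree k, and from
   degree k on they are congruent to - l^s F. *)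
Lemma affine_ideal_saturation k F : F \is k.-homog -> I F -> exists s, J (l ^+ s * F).
Proof.
move=> hFk [j [b [hj e]]].
have comp n : pihomog mdeg n F = pihomog mdeg n j
    + (if (0 < n)%N then l * pihomog mdeg n.-1 b else 0) - pihomog mdeg n b.
  rewrite e mulrBr mulr1 mulrC !raddfD raddfN /= (pihomogMl _ _ hl) addrA.
  by case: n => [|n] //=; rewrite subSS subn0.
have low n : (n < k)%N -> J (pihomog mdeg n b).
  elim: n => [|n IH] nk.
    have := comp 0%N; rewrite (pihomog_ne0 _ hFk) ?gtn_eqF // addr0 => /esym/eqP.
    by rewrite subr_eq0 => /eqP <-; exact: jacobian_ideal_pihomog.
  have := comp n.+1; rewrite (pihomog_ne0 _ hFk) ?gtn_eqF //= => /esym/eqP.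
  rewrite subr_eq0 => /eqP <-; apply: (idealD hJ); first exact: jacobian_ideal_pihomog.
  by apply: (idealM hJ); apply: IH; exact: ltnW.
have high s : J (pihomog mdeg (k + s) b + l ^+ s * F).
  elim: s => [|s IH].
    rewrite addn0 mul1r -[X in _ + X](pihomog_dE hFk) comp addrC subrK.
    apply: (idealD hJ); first exact: jacobian_ideal_pihomog.
    case: k hFk low {comp} => [|k] hFk low /=; first exact: (ideal0 hJ).
    by apply: (idealM hJ); exact: low.
  have := comp (k + s).+1; rewrite (pihomog_ne0 _ hFk) ?ltn_eqF ?ltnS ?leq_addr //= => /esym/eqP.
  rewrite subr_eq0 addnS => /eqP <-.
  have -> : pihomog mdeg (k + s).+1 j + l * pihomog mdeg (k + s) b + l ^+ s.+1 * F
    = pihomog mdeg (k + s).+1 j + l * (pihomog mdeg (k + s) b + l ^+ s * F).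
    by rewrite exprS; ring.
  by apply: (idealD hJ); [exact: jacobian_ideal_pihomog | exact: (idealM hJ)].
exists (msize b); have := high (msize b); rewrite [pihomog _ _ b]big1_seq ?add0r // => x.
move=> /andP[/eqP dx /msize_mdeg_lt]; rewrite /= in dx.
by rewrite dx ltnNge leq_addl.
Qed.

Lemma affine_ideal_homog_mem k F : (k0 <= k)%N -> F \is k.-homog -> I F -> J F.
Proof.
move=> kk hFk /(affine_ideal_saturation hFk) [s].
elim: s => [|s IH]; first by rewrite mul1r.
rewrite exprS -mulrA => h; apply: IH.
apply: (@line_cancel (s + k)) => //; first by apply: leq_trans kk _; exact: leq_addl.
by rewrite dhomogM // linear_form_expn.
Qed.

(** The [k.+1] forms [l ^+ (k - j) * 'X_i ^+ j] outnumber the codimension [N] of J_k, so a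
    nontrivial combination lies in J; setting l = 1 gives the polynomial. *)
Lemma affine_ideal_poly i : exists2 p : {poly K}, p != 0 & I (eval_var p i).
Proof.
pose k := (k0 + N)%N; have kk : (k0 <= k)%N by exact: leq_addr.
pose b (j : nat) : dhomog 3 K k := DHomog (pihomogP mdeg k (l ^+ (k - j) * 'X_i ^+ j)).
have bE (j : 'I_k.+1) : val (b j) = l ^+ (k - j) * 'X_i ^+ j.
  rewrite /= pihomog_dE // -[X in X.-homog](@subnK j k) -1?ltnS //.
  apply: dhomogM; first exact: linear_form_expn.
  by apply: linear_form_expn; rewrite dhomogX /= mdeg1.
pose g (c : 'rV[K]_k.+1) := \sum_j c 0 j *: b j.
have glin : linear g.
  move=> a c c'; rewrite /g scaler_sumr -big_split; apply: eq_bigr => j _.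
  by rewrite !mxE scalerDl scalerA.
pose gl : {linear 'rV[K]_k.+1 -> dhomog 3 K k} :=
  HB.pack g (GRing.isLinear.Build K 'rV[K]_k.+1 (dhomog 3 K k) _ g glin).
pose G := linfun gl; pose Jk := jacobian_piece f m k.
have GE c : G c = g c by rewrite lfunE.
have [c c0 hc] : exists2 c, c != 0 & G c \in Jk.
  apply: contrapT => h.
  have h' c : G c \in Jk -> c = 0.
    by move=> hc; apply/eqP/negPn/negP => c0; apply: h; exists c.
  have cap0 : (limg G :&: Jk)%VS = 0%VS.
    apply/eqP; rewrite -subv0; apply/subvP => y.
    by rewrite memv_cap => /andP[/memv_imgP [c _ ->] /h' ->]; rewrite linear0 mem0v.
  have dG : \dim (limg G) = k.+1.
    rewrite limg_dim_eq; first by rewrite dimvf /dim /= mul1n.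
    apply/eqP; rewrite capfv -subv0; apply/subvP => c; rewrite memv_ker => /eqP Gc.
    by rewrite memv0; apply/eqP/h'; rewrite Gc mem0v.
  have := dimv_disjoint_sum cap0; rewrite dG => e.
  have := dimvS (subvf (limg G + Jk)); rewrite e (hdim kk) -/Jk addnC leq_add2l.
  by rewrite /k ltnNge leq_addl.
exists (rVpoly c); first by rewrite -[0](linear0 (@rVpoly K k.+1)) (can_eq (@rVpolyK K _)).
have hGc : I (val (G c)).
  apply: affine_ideal_sub; move/mem_jacobian_piece: hc; apply=> //.
  exact: leq_trans kk.
apply: (ideal_congr hI _ hGc).
have -> : eval_var (rVpoly c) i = \sum_j c 0 j *: 'X_i ^+ j.
  rewrite /eval_var /rVpoly; rewrite poly_def rmorph_sum /= horner_sum.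
  apply: eq_bigr => j _; rewrite insubT /= => [|lt].
    exact: ltn_ord.
  rewrite -mul_polyC rmorphM /= map_polyC map_polyXn hornerCM hornerXn mul_mpolyC.
  by congr (c 0 _ *: _); apply: val_inj.
have -> : val (G c) = \sum_j c 0 j *: (l ^+ (k - j) * 'X_i ^+ j).
  by rewrite GE /g raddf_sum; apply: eq_bigr => j _; rewrite -bE.
rewrite -sumrB; apply: (ideal_sum _ hI) => j _.
rewrite -scalerBr -mul_mpolyC; apply: (idealM hI).
have -> : 'X_i ^+ j - l ^+ (k - j) * 'X_i ^+ j = - 'X_i ^+ j * (l ^+ (k - j) - 1) by ring.
by apply: (idealM hI); exact: affine_ideal_lX.
Qed.

Lemma affine_nullstellensatz (a : {mpoly K[3]} -> Prop) : is_ideal a -> (forall g, I g -> a g) ->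
  (forall v, (forall g, I g -> g.@[v] = 0) -> exists2 g, a g & g.@[v] != 0) -> a 1.
Proof.
move=> ha sub hz; apply: contrapT => na.
have [|v hv] := cofinite_nullstellensatz ha na.
  by move=> i; have [p p0 /sub] := affine_ideal_poly i; exists p.
have [|g /hv ->] := hz v; last by rewrite eqxx.
by move=> g /sub /hv.
Qed.

End GenericLine.

(** * Singular points and localization at them *)

Section SingularPoints.
Variables (K : numClosedFieldType) (f l : {mpoly K[3]}) (d k0 N : nat).
Hypotheses (d1 : (1 < d)%N) (hf : f \is d.-homog) (hl : l \is 1.-homog) (l0 : l != 0).
Local Notation J := (jacobian_ideal f).
Hypothesis hline : forall k F, (k0 <= k)%N -> F \is k.-homog -> add_principal J l F.
Hypothesis mk0 : (d.-1 <= k0)%N.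
Hypothesis hdim : forall k, (k0 <= k)%N ->
  (\dim {:dhomog 3 K k} = \dim (jacobian_piece f d.-1 k) + N)%N.
Local Notation I := (affine_ideal f l).
Implicit Types (p q : 'rV[K]_3) (v : 'I_3 -> K).

Let hF i : f^`M(i) \is d.-1.-homog := mderiv_homog i hf.
Let hJ : is_ideal J := jacobian_ideal_ideal f.
Let hI : is_ideal I := affine_ideal_ideal f l.

Lemma jacobian_ideal_meval v g : (forall i, (f^`M(i)).@[v] = 0) -> J g -> g.@[v] = 0.
Proof.
by move=> hv [a ->]; rewrite raddf_sum /= big1 // => i _; rewrite mevalM hv mulr0.
Qed.

Lemma singular_point_grad p : singular_points f p -> forall i, (f^`M(i)).@[p 0] = 0.
Proof. by case. Qed.

(** Some ['X_i ^+ k0] lies in J + (l) and takes the value 1 at [p], by the normalization of [p],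
    while J vanishes there. *)
Lemma singular_point_line p : singular_points f p -> l.@[p 0] != 0.
Proof.
move=> [[i [pi _]] _ hp]; apply/eqP => lp.
have [|j [b [hj e]]] := hline (F := 'X_i ^+ k0) (leqnn _).
  by apply: linear_form_expn; rewrite dhomogX /= mdeg1.
have := congr1 (meval (p 0)) e.
rewrite mevalD mevalM lp mulr0 addr0 (jacobian_ideal_meval hp hj) rmorphXn /= mevalXU pi expr1n.
by move/eqP; rewrite oner_eq0.
Qed.

(* The representative of [p] on the affine plane [l = 1]. *)
Definition affine_point p (j : 'I_3) : K := (l.@[p 0])^-1 * p 0 j.
Local Notation hat := affine_point.

Lemma meval_affine_point n F p : F \is n.-homog ->
  F.@[hat p] = (l.@[p 0])^-1 ^+ n * F.@[p 0].
Proof. exact: meval_homog. Qed.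

Lemma meval_affine_point_neq0 n F p : F \is n.-homog -> singular_points f p ->
  (F.@[hat p] != 0) = (F.@[p 0] != 0).
Proof.
move=> hFn hp; rewrite (meval_affine_point p hFn) mulf_eq0 expf_eq0 invr_eq0.
by rewrite (negPf (singular_point_line hp)) andbF.
Qed.

Lemma meval_affine_line p : singular_points f p -> l.@[hat p] = 1.
Proof. by move=> hp; rewrite (meval_affine_point p hl) mulVf // singular_point_line. Qed.

Lemma affine_ideal_meval p g : singular_points f p -> I g -> g.@[hat p] = 0.
Proof.
move=> hp [j [b [hj ->]]].
rewrite mevalD mevalM mevalB meval1 (meval_affine_line hp) subrr mulr0 addr0.
apply: jacobian_ideal_meval hj => i.
by rewrite (meval_affine_point p (hF i)) (singular_point_grad hp) mulr0.
Qed.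

(** A zero satisfies l = 1, so it is not the origin; dividing by its first nonzero coordinate gives
    the normalized representative. *)
Lemma affine_ideal_zero v : (forall g, I g -> g.@[v] = 0) ->
  exists2 p, singular_points f p & v =1 hat p.
Proof.
move=> hv; have lv : l.@[v] = 1.
  have := hv _ (add_principal_gen (l - 1) hJ).
  by rewrite mevalB meval1 => /eqP; rewrite subr_eq0 => /eqP.
have gv i : (f^`M(i)).@[v] = 0 by apply: hv; apply: affine_ideal_sub; exact: ideal_span_gen.
have [i vi vj] : exists2 i, v i != 0 & forall j : 'I_3, (j < i)%N -> v j = 0.
  have [v0|v0] := eqVneq (v 0) 0; last by exists 0.
  have [v1|v1] := eqVneq (v 1) 0; last first.
    by exists 1 => //; apply: forall_ord3.
  exists 2; last by apply: forall_ord3.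
  apply/eqP => v2; move: lv; have v00 : v =1 fun=> 0 * 0 by rewrite mul0r; apply: forall_ord3.
  rewrite (meval_eq _ v00) (meval_homog _ (fun=> 0) hl) expr1 mul0r => /eqP.
  by rewrite eq_sym oner_eq0.
pose p : 'rV[K]_3 := \row_j ((v i)^-1 * v j).
have pE j : p 0 j = (v i)^-1 * v j by rewrite mxE.
have lp : l.@[p 0] = (v i)^-1 by rewrite (meval_eq _ pE) (meval_homog _ _ hl) lv expr1 mulr1.
exists p; last by move=> j; rewrite /affine_point lp invrK pE mulVKf.
have gp j : (f^`M(j)).@[p 0] = 0 by rewrite (meval_eq _ pE) (meval_homog _ _ (hF j)) gv mulr0.
split=> //.
  by exists i; rewrite pE mulVf //; split=> // j /vj vj0; rewrite pE vj0 mulr0.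
exact: (jacobian_ideal_meval gp (jacobian_ideal_self (ltnW d1) hf)).
Qed.

Lemma affine_point_inj p q : singular_points f p -> singular_points f q ->
  hat p =1 hat q -> p = q.
Proof.
move=> hp hq e; have lp := singular_point_line hp; have lq := singular_point_line hq.
set c := l.@[p 0] / l.@[q 0].
have c0 : c != 0 by rewrite mulf_neq0 ?invr_eq0.
have pq j : p 0 j = c * q 0 j by rewrite /c -mulrA -[_ * q 0 j]/(hat q j) -e mulVKf.
have [[i [pi pj]] _ _] := hp; have [[i' [qi qj]] _ _] := hq.
have ii : i = i'.
  apply/val_inj; have [lt|lt|//] := ltngtP i i'.
    by have := pq i; rewrite (qj _ lt) pi mulr0 => /eqP; rewrite oner_eq0.
  by have := pq i'; rewrite (pj _ lt) qi mulr1 => /esym/eqP; rewrite (negPf c0).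
have c1 : c = 1 by rewrite -pi pq ii qi mulr1.
by apply/rowP => j; rewrite pq c1 mul1r.
Qed.

Lemma affine_coord_root i : exists2 P : {poly K}, P != 0 &
  I (eval_var P i) /\ forall p, singular_points f p -> root P (hat p i).
Proof.
have [P P0 hP] := affine_ideal_poly hF hl mk0 hdim i; exists P => //; split=> // p hp.
by rewrite /root -eval_var_meval; apply/eqP; exact: affine_ideal_meval.
Qed.

(** Each coordinate of an affine representative is a root of a fixed nonzero polynomial, which
    leaves finitely many candidates. *)
Lemma singular_points_seq : exists s : seq 'rV[K]_3,
  uniq s /\ forall p, p \in s <-> singular_points f p.
Proof.
have rs i : exists s : seq K, forall p, singular_points f p -> hat p i \in s.
  have [P P0 [_ hP]] := affine_coord_root i; have [s es] := closed_field_poly_normal P.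
  exists s => p /hP; rewrite es rootZ ?lead_coef_eq0 //.
  by rewrite root_prod_XsubC.
have [s0 h0] := rs 0; have [s1 h1] := rs 1; have [s2 h2] := rs 2.
pose A : set (K * K * K) := ([set` s0] `*` [set` s1] `*` [set` s2])%classic.
pose g (x : K * K * K) : 'rV[K]_3 := xget 0
  [set p | singular_points f p /\ (hat p 0, hat p 1, hat p 2) = x]%classic.
have fin : finite_set (singular_points f).
  apply: (@sub_finite_set _ _ (g @` A)%classic); last first.
    by apply: finite_image; do 2?apply: finite_setX; exact: finite_seq.
  move=> p hp; exists (hat p 0, hat p 1, hat p 2).
    by split; [split; [exact: h0|exact: h1]|exact: h2].
  apply: xget_unique => // q [hq [e0 e1 e2]].
  by apply: (affine_point_inj hq hp); apply: forall_ord3.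
have /finite_seqP [s es] := fin; exists (undup s); split; first exact: undup_uniq.
by move=> p; rewrite mem_undup es.
Qed.

(** The class of [F] vanishes in the localization of S/J at [p], with homogeneous denominators;
    [affine_local] is the counterpart on the plane l = 1. *)
Definition local_member p F := exists n B, [/\ B \is n.-homog, B.@[p 0] != 0 & J (B * F)].

Definition affine_local p g := exists b, b.@[hat p] != 0 /\ I (b * g).

Lemma affine_local_ideal p : is_ideal (affine_local p).
Proof.
split.
- by exists 1; rewrite meval1 oner_eq0 mulr0; split=> //; exact: (ideal0 hI).
- move=> x y [b [hb Ib]] [c [hc Ic]]; exists (b * c); rewrite mevalM mulf_neq0 //; split=> //.
  have -> : b * c * (x + y) = c * (b * x) + b * (c * y) by ring.
  by apply: (idealD hI); exact: (idealM hI).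
- move=> a x [b [hb Ib]]; exists b; split=> //.
  by have -> : b * (a * x) = a * (b * x) by [ring]; exact: (idealM hI).
Qed.

Lemma affine_local_sub p g : I g -> affine_local p g.
Proof. by exists 1; rewrite meval1 oner_eq0 mul1r. Qed.

(** To make a denominator homogeneous, it is replaced by a form congruent to it modulo the affine
    ideal; [affine_ideal_saturation] then returns to J at the cost of a power of l, which is nonzero
    at [p]. *)
Lemma affine_localP p F k : singular_points f p -> F \is k.-homog ->
  affine_local p F <-> local_member p F.
Proof.
move=> hp hFk; split; last first.
  move=> [n [B [hB Bp JB]]]; exists B; rewrite (meval_affine_point_neq0 hB hp); split=> //.
  exact: affine_ideal_sub.
move=> [b [bp Ib]].
have [B hB IB] := affine_ideal_homog hF hl hline b (leqnn k0).
have Bp : B.@[p 0] != 0.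
  rewrite -(meval_affine_point_neq0 hB hp).
  have := affine_ideal_meval hp IB; rewrite mevalB => /eqP; rewrite subr_eq0 => /eqP <-.
  exact: bp.
have [|s hs] := affine_ideal_saturation hF hl (dhomogM hB hFk).
  have -> : B * F = b * F - F * (b - B) by ring.
  by apply: (idealB hI) => //; exact: (idealM hI).
exists (s + k0)%N, (l ^+ s * B); split; last by rewrite -mulrA.
  by rewrite dhomogM // linear_form_expn.
by rewrite mevalM rmorphXn mulf_neq0 //= expf_neq0 // singular_point_line.
Qed.

(** Factor the highest power of X - a out of [P], where a is coordinate [j] of the affine point: the
    cofactor [Q] does not vanish at a and serves as denominator. *)
Lemma affine_local_pow p j : singular_points f p ->
  exists e, affine_local p (('X_j - (hat p j)%:MP) ^+ e).
Proof.
move=> hp; have [P P0 [IP _]] := affine_coord_root j.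
have [e [Q]] := multiplicity_XsubC P (hat p j); rewrite P0 /= => Qp eP.
exists e, (eval_var Q j); split; first by rewrite eval_var_meval.
rewrite -eval_var_linear; have evX k (R : {poly K}) : eval_var R j ^+ k = eval_var (R ^+ k) j.
  by elim: k => [|k IH]; rewrite ?expr0 ?exprS ?eval_varM ?IH // /eval_var rmorph1 hornerC.
by rewrite evX -eval_varM -eP.
Qed.

(** The [g] with [g * F] in the affine ideal form an ideal that contains the affine ideal and has no
    zero at a singular point; so it contains 1. *)
Lemma local_member_global k F : (k0 <= k)%N -> F \is k.-homog ->
  (forall p, singular_points f p -> local_member p F) -> J F.
Proof.
move=> kk hFk hloc; apply: (affine_ideal_homog_mem hF hl l0 hline mk0 hdim kk hFk).
pose a g := I (g * F).
have ha : is_ideal a.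
  split; rewrite /a; first by rewrite mul0r; exact: (ideal0 hI).
    by move=> x y hx hy; rewrite mulrDl; exact: (idealD hI).
  by move=> c x hx; rewrite -mulrA; exact: (idealM hI).
suff : a 1 by rewrite /a mul1r.
apply: (affine_nullstellensatz hF hl mk0 hdim ha).
  by move=> g hg; rewrite /a mulrC; exact: (idealM hI).
move=> v /affine_ideal_zero [p hp ev]; have [n [B [hB Bp JB]]] := hloc p hp.
exists B; first exact: affine_ideal_sub.
by rewrite (meval_eq _ ev) (meval_affine_point_neq0 hB hp).
Qed.

(** Chinese remainder theorem in one degree: [F] represents the fraction A/B at [p] and 0 at the
    other singular points. The factor [l ^+ k] equalizes the degrees and is 1 on the plane l = 1. *)
Lemma local_surjective k p A B M : (k0 <= k)%N -> singular_points f p ->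
  A \is M.-homog -> B \is M.-homog -> B.@[p 0] != 0 ->
  exists F, [/\ F \is k.-homog, local_member p (B * F - l ^+ k * A) &
    forall q, singular_points f q -> q != p -> local_member q F].
Proof.
move=> kk hp hA hB Bp.
pose R r := forall q, singular_points f q -> q != p -> affine_local q r.
have hR : is_ideal R.
  split=> [q _ _|x y hx hy q hq qp|a x hx q hq qp].
  - exact: (ideal0 (affine_local_ideal q)).
  - by apply: (idealD (affine_local_ideal q)); [exact: hx|exact: hy].
  - by apply: (idealM (affine_local_ideal q)); exact: hx.
pose a x := exists g r, [/\ affine_local p g, R r & x = g + B * r].
have hQ := affine_local_ideal p.
have ha : is_ideal a.
  split.
  - by exists 0, 0; split; [exact: (ideal0 hQ)|exact: (ideal0 hR)|rewrite mulr0 addr0].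
  - move=> x y [g [r [hg hr ->]]] [g' [r' [hg' hr' ->]]]; exists (g + g'), (r + r').
    by split; [exact: (idealD hQ)|exact: (idealD hR)|ring].
  - move=> c x [g [r [hg hr ->]]]; exists (c * g), (c * r).
    by split; [exact: (idealM hQ)|exact: (idealM hR)|ring].
(* [r] is a product, over the other singular points q, of powers of X_j - q_j, where coordinate [j]
   separates q from [p]; [affine_local_pow] provides the exponents. *)
have [r Rr rp] : exists2 r, R r & r.@[hat p] != 0.
  have [s [_ hs]] := singular_points_seq.
  suff H (t : seq 'rV[K]_3) : {subset t <= s} -> exists2 r,
      forall q, q \in t -> q != p -> affine_local q r & r.@[hat p] != 0.
    have [r hr rp] := H s (fun _ h => h).
    by exists r => // q /hs; exact: hr.
  elim: t => [|q t IH] sub; first by exists 1; rewrite ?meval1 ?oner_eq0.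
  have [|r hr rp] := IH; first by move=> x xt; apply: sub; rewrite inE xt orbT.
  have [->|qp] := eqVneq q p.
    by exists r => // x; rewrite inE => /orP[/eqP -> /eqP //|]; exact: hr.
  have hq : singular_points f q by apply/hs/sub; rewrite mem_head.
  have [j hj] : exists j, hat p j != hat q j.
    apply: contrapT => h; move/eqP: qp; apply; apply: affine_point_inj => // j.
    by apply/eqP/negPn/negP => nj; apply: h; exists j; rewrite eq_sym.
  have [e he] := affine_local_pow j hq.
  exists (('X_j - (hat q j)%:MP) ^+ e * r); last first.
    by rewrite mevalM rmorphXn /= mevalB mevalXU mevalC mulf_neq0 // expf_neq0 // subr_eq0.
  move=> x; rewrite inE => /orP[/eqP -> _|xt xp].
    by rewrite mulrC; exact: (idealM (affine_local_ideal q)).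
  by apply: (idealM (affine_local_ideal x)); exact: hr.
(* As 1 = g + B r' with g locally in I at p and r' locally in I at the other points, A r'
   represents A / B at p and 0 elsewhere. *)
have [g [r' [hg hr' e1]]] : a 1.
  apply: (affine_nullstellensatz hF hl mk0 hdim ha).
    move=> x Ix; exists x, 0; split; [exact: affine_local_sub|exact: (ideal0 hR)|ring].
  move=> v /affine_ideal_zero [q hq ev].
  have [eqp|qp] := eqVneq q p.
    exists (B * r); first by exists 0, r; split; [exact: (ideal0 hQ)|exact: Rr|rewrite add0r].
    by rewrite (meval_eq _ ev) eqp mevalM mulf_neq0 // (meval_affine_point_neq0 hB hp).
  have [j hj] : exists j, hat q j != hat p j.
    apply: contrapT => h; move/eqP: qp; apply; apply: affine_point_inj => // j.
    by apply/eqP/negPn/negP => nj; apply: h; exists j.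
  have [e he] := affine_local_pow j hp.
  exists (('X_j - (hat p j)%:MP) ^+ e).
    by exists (('X_j - (hat p j)%:MP) ^+ e), 0; split=> //; [exact: (ideal0 hR)|ring].
  by rewrite rmorphXn /= mevalB mevalXU mevalC expf_neq0 // subr_eq0 ev.
have [F hFk IF] := affine_ideal_homog hF hl hline (A * r') kk.
exists F; split=> //; last first.
  move=> q hq qp; apply/(affine_localP hq hFk).
  have -> : F = A * r' - (A * r' - F) by ring.
  apply: (idealB (affine_local_ideal q)); last exact: affine_local_sub.
  by apply: (idealM (affine_local_ideal q)); exact: hr'.
have hBF : B * F - l ^+ k * A \is (M + k).-homog.
  apply: rpredB; first exact: dhomogM.
  by rewrite addnC; apply: dhomogM => //; exact: linear_form_expn.
apply/(affine_localP hp hBF).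
have -> : B * F - l ^+ k * A = - A * (l ^+ k - 1) - B * (A * r' - F) - A * g.
  have -> : A * g = A * (1 - B * r') by rewrite e1 addrK.
  ring.
apply: (idealB hQ); last exact: (idealM hQ).
apply: (idealB hQ); apply: (idealM hQ); apply: affine_local_sub => //.
exact: affine_ideal_lX.
Qed.

End SingularPoints.

(** * Local Tjurina algebras *)

Section Dehomogenization.
Variables (K : numClosedFieldType) (i : 'I_3).
Local Notation delta := (dehomogenize i).
Implicit Types (F G : {mpoly K[3]}).

Lemma dehomogenizeM : {morph (delta : {mpoly K[3]} -> {mpoly K[2]}) : F G / F * G}.
Proof. by move=> F G; rewrite /dehomogenize rmorphM. Qed.

Lemma dehomogenizeD : {morph (delta : {mpoly K[3]} -> {mpoly K[2]}) : F G / F + G}.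
Proof. by move=> F G; rewrite /dehomogenize rmorphD. Qed.

Lemma dehomogenizeB : {morph (delta : {mpoly K[3]} -> {mpoly K[2]}) : F G / F - G}.
Proof. by move=> F G; rewrite /dehomogenize rmorphB. Qed.

Lemma dehomogenizeXn n : {morph (delta : {mpoly K[3]} -> {mpoly K[2]}) : F / F ^+ n}.
Proof. by move=> F; rewrite /dehomogenize rmorphXn. Qed.

Lemma dehomogenizeZ c F : delta (c *: F) = c%:MP * delta F.
Proof. by rewrite /dehomogenize linearZ mul_mpolyC. Qed.

Lemma dehomogenizeC c : delta (c%:MP : {mpoly K[3]}) = c%:MP.
Proof. by rewrite /dehomogenize comp_mpolyC. Qed.

Lemma dehomogenize_sum n (F : 'I_n -> {mpoly K[3]}) : delta (\sum_j F j) = \sum_j delta (F j).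
Proof. by rewrite /dehomogenize raddf_sum. Qed.

Lemma dehomogenizeX j : delta ('X_j : {mpoly K[3]}) = if unlift i j is Some k then 'X_k else 1.
Proof. by rewrite /dehomogenize /comp_mpoly mmapX mmap1U tnth_mktuple. Qed.

Lemma dehomogenize_meval F v :
  (delta F).@[v] = F.@[fun j => if unlift i j is Some k then v k else 1].
Proof.
rewrite /dehomogenize comp_mpoly_meval; apply: meval_eq => j; rewrite tnth_mktuple.
by case: unlift => [k|]; rewrite ?mevalXU ?meval1.
Qed.

Lemma dehomogenize_meval_homog n F (x : 'I_3 -> K) : x i != 0 -> F \is n.-homog ->
  (delta F).@[fun k => x (lift i k) / x i] = (x i)^-1 ^+ n * F.@[x].
Proof.
move=> xi hF; rewrite dehomogenize_meval -(meval_homog _ _ hF); apply: meval_eq => j.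
by case: unliftP => [k ->|->]; rewrite ?mulVf // mulrC.
Qed.

Lemma dehomogenize_inj n F : F \is n.-homog -> delta F = 0 -> F = 0.
Proof.
move=> hF F0; suff : F * 'X_i = 0.
  move/eqP; rewrite mulf_eq0 => /orP[/eqP //|/eqP X0].
  have := congr1 (meval (fun=> 1)) X0; rewrite mevalXU meval0 => /eqP.
  by rewrite oner_eq0.
apply: mpoly_eq0_meval => x; rewrite mevalM mevalXU.
have [->|xi] := eqVneq (x i) 0; first by rewrite mulr0.
have := dehomogenize_meval_homog xi hF; rewrite F0 meval0 => /esym/eqP.
by rewrite mulf_eq0 expf_eq0 invr_eq0 (negPf xi) andbF /= => /eqP ->; rewrite mul0r.
Qed.

Lemma dehomogenize_lift (b : {mpoly K[2]}) : exists N0, forall N, (N0 <= N)%N ->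
  exists2 F : {mpoly K[3]}, F \is N.-homog & delta F = b.
Proof.
pose phi : {rmorphism {mpoly K[3]} -> {mpoly K[2]}} :=
  comp_mpoly [tuple if unlift i j is Some k then 'X_k else 1 | j < 3].
have hX j : ('X_j : {mpoly K[3]}) \is 1.-homog by rewrite dhomogX /= mdeg1.
have phiX : phi 'X_i = 1.
  by rewrite -[LHS]/(delta 'X_i) dehomogenizeX unlift_none.
suff : liftable phi b by [].
elim/mpolyind: b => [|c m p _ _ IH].
  by rewrite -mpolyC0 -(dehomogenizeC 0); exact: (liftableC (hX i) phiX).
apply: liftableD => //; rewrite -mul_mpolyC; apply: (liftableM (hX i) phiX).
  by rewrite -dehomogenizeC; exact: (liftableC (hX i) phiX).
rewrite mpolyXE_id; elim/big_ind: _ => [|x y|k _].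
- by rewrite -mpolyC1 -dehomogenizeC; exact: (liftableC (hX i) phiX).
- exact: (liftableM (hX i) phiX).
- elim: (m k) => [|e IHe].
    by rewrite expr0 -mpolyC1 -dehomogenizeC; exact: (liftableC (hX i) phiX).
  rewrite exprS; apply: (liftableM (hX i) phiX) IHe.
  have -> : 'X_k = phi 'X_(lift i k).
    by rewrite -[RHS]/(delta 'X_(lift i k)) dehomogenizeX liftK.
  exact: (liftable_homog (hX i) phiX (hX _)).
Qed.

Lemma dehomogenize_deriv F k : (delta F)^`M(k) = delta (F^`M(lift i k)).
Proof.
pose phi : {rmorphism {mpoly K[3]} -> {mpoly K[2]}} :=
  comp_mpoly [tuple if unlift i j is Some k then 'X_k else 1 | j < 3].
pose D1 : {additive {mpoly K[3]} -> {mpoly K[2]}} := @mderiv _ _ k \o phi.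
pose D2 : {additive {mpoly K[3]} -> {mpoly K[2]}} := phi \o @mderiv _ _ (lift i k).
apply: (derivation_ext (phi := phi) (D1 := D1) (D2 := D2)) => [c|c|p q|p q|j] /=.
- by rewrite comp_mpolyC mderivC.
- by rewrite mderivC comp_mpoly0.
- by rewrite rmorphM mderivM.
- by rewrite mderivM rmorphD !rmorphM.
- rewrite -[comp_mpoly _ 'X_j]/(delta 'X_j) -[comp_mpoly _ _]/(delta _) dehomogenizeX mderivX.
  rewrite dehomogenizeZ mnm1E.
  case: unliftP => [k' ->|->]; last by rewrite -mpolyC1 mderivC eq_liftF mpolyC0 mul0r.
  rewrite mderivX mnm1E (inj_eq lift_inj); have [->|_] := eqVneq k' k; last first.
    by rewrite scale0r mpolyC0 mul0r.
  have E n (j' : 'I_n) : (U_(j') - U_(j'))%MM = 0%MM by apply/mnmP => x; rewrite mnmBE subnn mnm0E.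
  by rewrite !E !mpolyX0 scale1r mpolyC1 mul1r -mpolyC1 dehomogenizeC.
Qed.

End Dehomogenization.

Section LocalAlgebra.
Variables (K : fieldType) (n : nat) (g : {mpoly K[n]}) (q : 'I_n -> K).
Local Notation "x %:F" := (tofrac x) : ring_scope.
Local Notation O := (local_ring q).
Local Notation T := (tjurina_ideal g q).

Let neq0F (b : {mpoly K[n]}) : b.@[q] != 0 -> b%:F != 0.
Proof. by move=> h; rewrite tofrac_eq0; apply: contraNneq h => ->; rewrite meval0. Qed.

Lemma local_ring_poly (a : {mpoly K[n]}) : O a%:F.
Proof. by exists a, 1; rewrite meval1 oner_eq0 rmorph1 divr1. Qed.

Lemma local_ring_inv (b : {mpoly K[n]}) : b.@[q] != 0 -> O (b%:F)^-1.
Proof. by move=> hb; exists 1, b; rewrite rmorph1 mul1r. Qed.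

Lemma local_ringM u v : O u -> O v -> O (u * v).
Proof.
move=> [a [b [hb ->]]] [a' [b' [hb' ->]]]; exists (a * a'), (b * b').
by rewrite mevalM mulf_neq0 // !rmorphM /= mulf_div.
Qed.

Lemma local_ringD u v : O u -> O v -> O (u + v).
Proof.
move=> [a [b [hb ->]]] [a' [b' [hb' ->]]]; exists (a * b' + a' * b), (b * b').
rewrite mevalM mulf_neq0 // addf_div ?neq0F //.
by split=> //; rewrite rmorphD !rmorphM.
Qed.

Lemma tjurina_idealM c u : O c -> T u -> T (c * u).
Proof.
move=> hc [a [b [ha hb ->]]]; exists (c * a), (fun k => c * b k); split.
- exact: local_ringM.
- by move=> k; exact: local_ringM.
- by rewrite mulrDr mulrA mulr_sumr; congr (_ + _); apply: eq_bigr => k _; rewrite mulrA.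
Qed.

Lemma tjurina_idealD u v : T u -> T v -> T (u + v).
Proof.
move=> [a [b [ha hb ->]]] [a' [b' [ha' hb' ->]]]; exists (a + a'), (fun k => b k + b' k); split.
- exact: local_ringD.
- by move=> k; exact: local_ringD.
- rewrite mulrDl addrACA -big_split; congr (_ + _).
  by apply: eq_bigr => k _; rewrite mulrDl.
Qed.

Lemma tjurina_ideal_self : T g%:F.
Proof.
exists 1, (fun=> 0); split; [|move=> k|].
- by rewrite -(rmorph1 (@tofrac _)); exact: local_ring_poly.
- by rewrite -(rmorph0 (@tofrac _)); exact: local_ring_poly.
- by rewrite mul1r big1 ?addr0 // => k _; rewrite mul0r.
Qed.

Lemma tjurina_ideal_deriv k : T (g^`M(k))%:F.
Proof.
exists 0, (fun j => (j == k)%:R); split; [|move=> j|].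
- by rewrite -(rmorph0 (@tofrac _)); exact: local_ring_poly.
- by rewrite -(rmorph_nat (@tofrac _)); exact: local_ring_poly.
- rewrite mul0r add0r (bigD1 k) //= eqxx mul1r big1 ?addr0 // => j /negPf ->.
  by rewrite mul0r.
Qed.

Lemma tjurina_ideal0 : T 0.
Proof.
rewrite -(mul0r g%:F); apply: tjurina_idealM; last exact: tjurina_ideal_self.
by rewrite -(rmorph0 (@tofrac _)); exact: local_ring_poly.
Qed.

(** All denominators are cleared at once by a polynomial [c] that does not vanish at [q]. *)
Lemma tjurina_ideal_poly u : T u -> exists c a (b : 'I_n -> {mpoly K[n]}),
  c.@[q] != 0 /\ c%:F * u = (a * g + \sum_k b k * g^`M(k))%:F.
Proof.
pose W u := exists c a (b : 'I_n -> {mpoly K[n]}),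
  c.@[q] != 0 /\ c%:F * u = (a * g + \sum_k b k * g^`M(k))%:F.
have WD x y : W x -> W y -> W (x + y).
  move=> [c [a [b [hc e]]]] [c' [a' [b' [hc' e']]]].
  exists (c * c'), (c' * a + c * a'), (fun k => c' * b k + c * b' k).
  rewrite mevalM mulf_neq0 //; split=> //.
  have -> : (c * c')%:F * (x + y) = c'%:F * (c%:F * x) + c%:F * (c'%:F * y).
    by rewrite rmorphM /=; ring.
  rewrite e e' -!rmorphM -rmorphD; congr (_ %:F).
  rewrite !mulrDr !mulr_sumr.
  under [X in _ = _ + X]eq_bigr => k _ do rewrite mulrDl.
  rewrite big_split /= mulrDl !mulrA addrACA; congr (_ + (_ + _)).
    by apply: eq_bigr => k _; rewrite mulrA.
  by apply: eq_bigr => k _; rewrite mulrA.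
have WM z x : O z -> W x -> W (z * x).
  move=> [z0 [z1 [hz ->]]] [c [a [b [hc e]]]].
  exists (z1 * c), (z0 * a), (fun k => z0 * b k); rewrite mevalM mulf_neq0 //; split=> //.
  have -> : (z1 * c)%:F * (z0%:F / z1%:F * x) = (z1%:F / z1%:F) * z0%:F * (c%:F * x).
    by rewrite rmorphM /=; ring.
  rewrite divff ?neq0F // mul1r e -rmorphM; congr (_ %:F).
  by rewrite mulrDr mulrA mulr_sumr; congr (_ + _); apply: eq_bigr => k _; rewrite mulrA.
have W1 : W g%:F.
  exists 1, 1, (fun=> 0); rewrite meval1 oner_eq0 rmorph1 !mul1r big1 ?addr0 //.
  by move=> k _; rewrite mul0r.
have Wd k : W (g^`M(k))%:F.
  exists 1, 0, (fun j => (j == k)%:R); rewrite meval1 oner_eq0 rmorph1 mul1r mul0r add0r; split=> //.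
  rewrite (bigD1 k) //= eqxx mul1r big1 ?addr0 // => j /negPf ->.
  by rewrite mul0r.
move=> [a [b [ha hb ->]]]; apply: (WD); first exact: WM.
elim/big_ind: _ => [|x y|k _]; last exact: WM.
  exists 1, 0, (fun=> 0); rewrite meval1 oner_eq0 mulr0 mul0r add0r big1 ?rmorph0 //.
  by move=> k _; rewrite mul0r.
exact: WD.
Qed.

End LocalAlgebra.

Lemma sub_frac_common (F : fieldType) (a b x y : F) : b != 0 -> y != 0 ->
  a / b - x = - (b * y)^-1 * (b * y * x - y * a).
Proof. by move=> b0 y0; field; rewrite b0 y0. Qed.

(** * Tjurina algebras as quotients of forms of large degree *)

Section TjurinaNumbers.
Variables (K : numClosedFieldType) (f l : {mpoly K[3]}) (d k0 N : nat).
Hypotheses (d1 : (1 < d)%N) (hf : f \is d.-homog) (hl : l \is 1.-homog) (l0 : l != 0).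
Local Notation J := (jacobian_ideal f).
Hypothesis hline : forall k F, (k0 <= k)%N -> F \is k.-homog -> add_principal J l F.
Hypothesis mk0 : (d.-1 <= k0)%N.
Hypothesis hdim : forall k, (k0 <= k)%N ->
  (\dim {:dhomog 3 K k} = \dim (jacobian_piece f d.-1 k) + N)%N.
Local Notation "x %:F" := (tofrac x) : ring_scope.
Implicit Types (p : 'rV[K]_3).

Let hF i : f^`M(i) \is d.-1.-homog := mderiv_homog i hf.
Let hJ : is_ideal J := jacobian_ideal_ideal f.

Section AtPoint.
Variables (p : 'rV[K]_3) (i : 'I_3).
Hypotheses (hp : singular_points f p) (pi0 : p 0 i != 0).
Local Notation delta := (dehomogenize i).
Local Notation q := (fun k : 'I_2 => p 0 (lift i k) / p 0 i).
Local Notation O := (local_ring q).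
Local Notation T := (tjurina_ideal (delta f) q).

Lemma dehomogenize_meval_neq0 n (F : {mpoly K[3]}) : F \is n.-homog ->
  ((delta F).@[q] != 0) = (F.@[p 0] != 0).
Proof.
move=> hFn; rewrite (dehomogenize_meval_homog pi0 hFn) mulf_eq0 expf_eq0 invr_eq0.
by rewrite (negPf pi0) andbF.
Qed.

(** The partials in the chart variables dehomogenize to partials of [delta f]; the remaining one,
    along coordinate [i], is recovered from Euler's relation, which brings in [delta f] itself. *)
Lemma tjurina_ideal_jacobian F : J F -> T (delta F)%:F.
Proof.
have hgrad j : T (delta (f^`M(j)))%:F.
  case: (unliftP i j) => [k ->|->].
    by rewrite -dehomogenize_deriv; exact: tjurina_ideal_deriv.
  have := congr1 (fun x => delta x) (euler_identity hf).
  rewrite dehomogenize_sum (bigD1 i) //= dehomogenizeM dehomogenizeX unlift_none mul1r.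
  move=> /(canRL (addrK _)) ->.
  rewrite -scaler_nat dehomogenizeZ rmorphB rmorphM /=.
  apply: tjurina_idealD.
    by apply: tjurina_idealM; [exact: local_ring_poly|exact: tjurina_ideal_self].
  rewrite -rmorphN -sumrN rmorph_sum /=.
  elim/big_ind: _ => [|x y|j' /eqP ij]; first exact: tjurina_ideal0.
    exact: tjurina_idealD.
  case: (unliftP i j') => [k e|//]; rewrite e dehomogenizeM -mulNr rmorphM /=.
  apply: tjurina_idealM; first exact: local_ring_poly.
  by rewrite -dehomogenize_deriv; exact: tjurina_ideal_deriv.
move=> [a ->]; rewrite dehomogenize_sum rmorph_sum /=.
elim/big_ind: _ => [|x y|j _]; first exact: tjurina_ideal0.
  exact: tjurina_idealD.
rewrite dehomogenizeM rmorphM /=; apply: tjurina_idealM => //; exact: local_ring_poly.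
Qed.

(** From left to right, denominators are cleared and the polynomial identity is lifted to forms of a
    common degree; from right to left, [delta B] is a unit of the local ring. *)
Lemma tjurina_ideal_localP k F : F \is k.-homog -> T (delta F)%:F <-> local_member f p F.
Proof.
move=> hFk; split.
  move=> /tjurina_ideal_poly [c [a [b [hc]]]]; rewrite -rmorphM => /eqP.
  rewrite tofrac_eq => /eqP e.
  have [Nc hNc] := dehomogenize_lift i c; have [Na hNa] := dehomogenize_lift i a.
  have /choice [Nb hNb] := fun j => dehomogenize_lift i (b j).
  (* [M] dominates all lifting bounds, and its summand [d] keeps [M + k - d] and [M + k - d.-1] from
     truncating. *)
  pose M := (Nc + Na + \sum_j Nb j + d)%N.
  have [C hC eC] := hNc M ltac:(rewrite /M; lia).
  have [A hA eA] := hNa (M + k - d)%N ltac:(rewrite /M; lia).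
  have /choice [Bf hBf] : forall j, exists B : {mpoly K[3]},
      B \is (M + k - d.-1).-homog /\ delta B = b j.
    move=> j; have [|B hB eB] := hNb j (M + k - d.-1)%N; last by exists B.
    by rewrite /M (bigD1 j) //=; lia.
  exists M, C; split=> //.
    by rewrite -(dehomogenize_meval_neq0 hC) eC.
  have -> : C * F = A * f + \sum_j Bf j * f^`M(lift i j).
    apply/eqP; rewrite -subr_eq0; apply/eqP; apply: (@dehomogenize_inj _ i (M + k)).
      apply: rpredB; first exact: dhomogM.
      apply: rpredD.
        by have := dhomogM hA hf; rewrite subnK // /M; lia.
      apply: rpred_sum => j _; have := dhomogM (hBf j).1 (hF (lift i j)).
      by rewrite subnK // /M; lia.
    rewrite dehomogenizeB dehomogenizeD !dehomogenizeM dehomogenize_sum eC eA e.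
    apply/eqP; rewrite subr_eq0; apply/eqP; congr (_ + _); apply: eq_bigr => j _.
    by rewrite dehomogenizeM (hBf j).2 dehomogenize_deriv.
  apply: (idealD hJ).
    by apply: (idealM hJ); exact: (jacobian_ideal_self (ltnW d1) hf).
  by apply: (ideal_sum _ hJ) => j _; apply: (idealM hJ); exact: ideal_span_gen.
move=> [n [B [hB Bp JB]]].
have Bq : (delta B).@[q] != 0 by rewrite (dehomogenize_meval_neq0 hB).
have B0 : (delta B)%:F != 0.
  by rewrite tofrac_eq0; apply: contraNneq Bq => ->; rewrite meval0.
rewrite -[X in T X](mulKf B0) -rmorphM -dehomogenizeM.
by apply: tjurina_idealM; [exact: local_ring_inv|exact: tjurina_ideal_jacobian].
Qed.

Lemma tjurina_surjective k u : (k0 <= k)%N -> O u ->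
  exists F, [/\ F \is k.-homog, T (u - (delta F)%:F) &
    forall p', singular_points f p' -> p' != p -> local_member f p' F].
Proof.
move=> kk [a [b [hb ->]]].
have [Na hNa] := dehomogenize_lift i a.
(* The extra factor [delta l ^+ k] in the denominator cancels the [l ^+ k] of [local_surjective]. *)
have [Nb hNb] := dehomogenize_lift i (b * delta l ^+ k).
have [A hA eA] := hNa (Na + Nb)%N ltac:(lia).
have [B hB eB] := hNb (Na + Nb)%N ltac:(lia).
have lq : (delta l).@[q] != 0.
  by rewrite (dehomogenize_meval_neq0 hl); exact: (singular_point_line hline hp).
have Bq : (delta B).@[q] != 0 by rewrite eB mevalM rmorphXn mulf_neq0 //= expf_neq0.
have Bp : B.@[p 0] != 0 by rewrite -(dehomogenize_meval_neq0 hB).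
have [F [hFk hloc hoth]] := local_surjective d1 hf hl hline mk0 hdim kk hp hA hB Bp.
exists F; split=> //.
have hh : B * F - l ^+ k * A \is (Na + Nb + k).-homog.
  apply: rpredB; first exact: dhomogM.
  by rewrite addnC; apply: dhomogM => //; exact: linear_form_expn.
have nz c : c.@[q] != 0 -> c%:F != 0.
  by move=> hc; rewrite tofrac_eq0; apply: contraNneq hc => ->; rewrite meval0.
have /(tjurina_ideal_localP hh) := hloc.
rewrite dehomogenizeB !dehomogenizeM dehomogenizeXn eA => hT.
have -> : a%:F / b%:F - (delta F)%:F
    = - ((delta B)%:F)^-1 * (delta B * delta F - delta l ^+ k * a)%:F.
  have bz := nz _ hb; have lz := nz _ lq.
  rewrite eB rmorphB !rmorphM !rmorphXn /=.
  have lkz : (delta l)%:F ^+ k != 0 by rewrite expf_neq0.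
  move: bz lkz; move: (a%:F) (b%:F) ((delta l)%:F ^+ k) ((delta F)%:F) => a' b' y' x' bz lkz.
  exact: (@sub_frac_common {fraction {mpoly K[2]}} a' b' x' y' bz lkz).
apply: tjurina_idealM hT; rewrite -mulN1r; apply: local_ringM; last exact: local_ring_inv.
by rewrite -(rmorphN1 (@tofrac _)); exact: local_ring_poly.
Qed.

(** S_k maps onto the Tjurina algebra, and the kernel consists of the forms that lie in J locally at
    [p]; so the Tjurina number is a codimension in S_k, in particular finite. *)
Lemma tjurina_codim k : (k0 <= k)%N -> exists U : {vspace dhomog 3 K k},
  (forall x, x \in U <-> local_member f p (val x)) /\ tjurina (delta f) q = \dim U^C.
Proof.
move=> kk.
have TZ c x : T x -> T ((c%:MP)%:F * x).
  by apply: tjurina_idealM; exact: local_ring_poly.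
pose W (x : dhomog 3 K k) := T (delta (val x))%:F.
have [U hU] : exists U : {vspace dhomog 3 K k}, forall x, x \in U <-> W x.
  apply: subspace_of_pred; rewrite /W.
    rewrite raddf0 -mpolyC0 dehomogenizeC mpolyC0 rmorph0; exact: tjurina_ideal0.
  move=> c x y hx hy; rewrite linearP dehomogenizeD dehomogenizeZ rmorphD rmorphM /=.
  by apply: tjurina_idealD => //; exact: TZ.
exists U; split=> [x|].
  rewrite hU; exact: (tjurina_ideal_localP (dhomog_is_dhomog x)).
pose pi (x : dhomog 3 K k) := (delta (val x))%:F.
have piD : {morph pi : x y / x + y}.
  by move=> x y; rewrite /pi raddfD dehomogenizeD rmorphD.
have piZ c x : pi (c *: x) = (c%:MP)%:F * pi x.
  by rewrite /pi linearZ dehomogenizeZ rmorphM.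
have piO x : O (pi x) by exact: local_ring_poly.
have pis u : O u -> exists x, T (u - pi x).
  move=> /(tjurina_surjective kk) [F [hFk hT _]]; by exists (DHomog hFk).
have TD x y : T x -> T y -> T (x + y) by exact: tjurina_idealD.
have T0 : T 0 by exact: tjurina_ideal0.
apply: xget_unique => [|n hn].
  exact: (has_quotient_dim_compl TD TZ piD piZ piO hU pis).
exact: (has_quotient_dim_unique TD T0 TZ piD piZ piO hU pis hn).
Qed.

End AtPoint.

Lemma singular_point_coord p : singular_points f p -> exists i, p 0 i != 0.
Proof. by move=> [[i [pi _]] _ _]; exists i; rewrite pi oner_eq0. Qed.

Lemma curve_tjurina_codim p k : singular_points f p -> (k0 <= k)%N ->
  exists U : {vspace dhomog 3 K k},
  (forall x, x \in U <-> local_member f p (val x)) /\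
  curve_tjurina f p = (\dim {:dhomog 3 K k} - \dim U)%N.
Proof.
move=> hp kk; rewrite /curve_tjurina; case: pickP => [i pi|no].
  have [U [hU ->]] := tjurina_codim hp pi kk; exists U.
  by rewrite dimv_compl.
by have [j] := singular_point_coord hp; rewrite no.
Qed.

(** The spaces [U p] of forms that lie in J locally at [p] meet in J_k0 by [local_member_global] and
    are independent by [tjurina_surjective]; so the local codimensions add up to the global one,
    [N]. *)
Lemma total_tjurina_eq : total_tjurina f = N.
Proof.
have [s [us hs]] := singular_points_seq hf hl hline mk0 hdim.
have -> : total_tjurina f = (\sum_(p <- s) curve_tjurina f p)%N.
  have es : singular_points f = [set` s]%classic by apply/seteqP; split=> p /hs.
  by rewrite /total_tjurina es -fsbig_seq.
have /choice [U hU] : forall p, exists U : {vspace dhomog 3 K k0}, singular_points f p ->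
    (forall x, x \in U <-> local_member f p (val x)) /\
    curve_tjurina f p = (\dim {:dhomog 3 K k0} - \dim U)%N.
  move=> p; have [hp|nhp] := pselect (singular_points f p); last by exists 0%VS.
  by have [U hU] := curve_tjurina_codim hp (leqnn k0); exists U.
have -> : (\sum_(p <- s) curve_tjurina f p
    = \sum_(p <- s) (\dim {:dhomog 3 K k0} - \dim (U p)))%N.
  by rewrite !big_seq; apply: eq_bigr => p /hs /hU [_ ->].
have := dim_bigcap_independent (U := U) us; rewrite (hdim (leqnn k0)).
have -> : (\bigcap_(p <- s) U p)%VS = jacobian_piece f d.-1 k0.
  apply/vspaceP => x; apply/idP/idP.
    move=> /memv_bigcap hx; apply/mem_jacobian_piece => //.
    apply: (local_member_global d1 hf hl l0 hline mk0 hdim (leqnn k0) (dhomog_is_dhomog x)).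
    by move=> p hp; have [e _] := hU p hp; apply/e/hx/hs.
  move=> /mem_jacobian_piece hx; apply/memv_bigcap => p /hs hp; have [e _] := hU p hp.
  apply/e; exists 0%N, 1; rewrite dhomog1 meval1 oner_eq0 mul1r; split=> //.
  exact: hx.
move=> h; suff /eqP : (\dim (jacobian_piece f d.-1 k0) + N =
  \dim (jacobian_piece f d.-1 k0) + \sum_(p <- s) (\dim (jacobian_piece f d.-1 k0) + N - \dim (U p)))%N.
  by rewrite eqn_add2l => /eqP <-.
apply: h => p x /hs hp; have [i pi] := singular_point_coord hp.
have [F [hFk hT hoth]] := tjurina_surjective hp pi (leqnn k0)
  (local_ring_poly _ (dehomogenize i (val x))).
exists (DHomog hFk); split.
  have [e _] := hU p hp; apply/e.
  have hsub : F - val x \is k0.-homog by rewrite rpredB // dhomog_is_dhomog.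
  have -> : val (DHomog hFk - x) = F - val x by rewrite raddfB.
  apply/(tjurina_ideal_localP pi hsub); rewrite dehomogenizeB rmorphB /=.
  rewrite -opprB -mulN1r; apply: tjurina_idealM => //.
  by rewrite -(rmorphN1 (@tofrac _)); exact: local_ring_poly.
move=> p' /hs hp' np; have [e _] := hU p' hp'; apply/e; exact: hoth.
Qed.

End TjurinaNumbers.

(** * Three-syzygy curves *)

Lemma mul2_bin_plane n : ('C(n + 2, n) * 2 = (n + 2) * (n + 1))%N.
Proof.
have := bin_ffact (n + 2) 2; rewrite -bin_sub ?leq_addl // addnK => ->.
by rewrite !addnS addn0 ffactnS ffactn1.
Qed.

Lemma bin_plane_int n : 2 * ('C(n + 2, n))%:Z = (n%:Z + 2) * (n%:Z + 1).
Proof. by have := congr1 Posz (mul2_bin_plane n); rewrite !PoszM !PoszD mulrC. Qed.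

(* The dimension count in degree k + m along the resolution of S/J. *)
Lemma hilbert_polynomial_constant (k m a b c : nat) :
  (a <= k)%N -> (b <= k)%N -> (c <= k)%N -> (m <= a + b + c)%N -> (a + b + c - m <= k)%N ->
  ('C(k + m + 2, k + m))%:Z + (('C(k - a + 2, k - a))%:Z + ('C(k - b + 2, k - b))%:Z
     + ('C(k - c + 2, k - c))%:Z)
  = 3 * ('C(k + 2, k))%:Z + ('C(k - (a + b + c - m) + 2, k - (a + b + c - m)))%:Z
    + (m%:Z * (a%:Z + b%:Z + c%:Z) - (a%:Z * b%:Z + a%:Z * c%:Z + b%:Z * c%:Z)).
Proof.
move=> ak bk ck ms sk; apply: (@mulfI int 2) => //.
have E (x y z t : int) : 2 * (x + (y + z + t)) = 2 * x + 2 * y + 2 * z + 2 * t by ring.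
have E' (x y z : int) : 2 * (3 * x + y + z) = 3 * (2 * x) + 2 * y + 2 * z by ring.
by rewrite E E' !bin_plane_int -!subzn // !PoszD; ring.
Qed.

Section ThreeSyzygyCurves.
Variables (K : numClosedFieldType) (d : nat) (f : {mpoly K[3]}).
Hypotheses (d1 : (1 < d)%N) (hf : reduced_curve d f).

Lemma exponents3 (a b c : nat) : exponents f [:: a; b; c] ->
  exists (D : 'I_3 -> nat) (r : 'I_3 -> 'rV[{mpoly K[3]}]_3),
  [/\ [/\ D 0%R = a, D 1%R = b & D 2%R = c], (D 0%R <= D 1%R <= D 2%R)%N,
      minimal_generators f r & forall j, homogeneous_triple (D j) (r j)].
Proof.
move=> [/= /and3P[ab bc _] [r [rmin rhom]]].
exists (fun j : 'I_3 => nth 0%N [:: a; b; c] j), r; split=> //=.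
by rewrite ab bc.
Qed.

Lemma exponents3_unique a b c a' b' c' :
  exponents f [:: a; b; c] -> exponents f [:: a'; b'; c'] -> [/\ a = a', b = b' & c = c'].
Proof.
have [f0 hd sqf] := hf.
move=> /exponents3 [D [r [[<- <- <-] sD rmin rhom]]] /exponents3 [D' [r' [[<- <- <-] sD' rmin' rhom']]].
have le := exponents_le d1 f0 hd sqf rmin rhom rmin' rhom' sD sD'.
have ge := exponents_le d1 f0 hd sqf rmin' rhom' rmin rhom sD' sD.
by split; apply/eqP; rewrite eqn_leq le ge.
Qed.

Lemma exponents3_sum_ge a b c : exponents f [:: a; b; c] -> (d <= a + b)%N.
Proof.
have [f0 hd sqf] := hf.
move=> /exponents3 [D [r [[<- <- _] /andP[D01 D12] rmin rhom]]].
have [h hb] := hilbert_burch_exists d1 f0 hd sqf rmin.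
exact: (degree_sum_ge d1 f0 hd sqf rmin rhom hb D01 D12).
Qed.

Lemma total_tjurina_exponents a b c : exponents f [:: a; b; c] ->
  (total_tjurina f)%:Z = (d%:Z - 1) * (a%:Z + b%:Z + c%:Z)
    - (a%:Z * b%:Z + a%:Z * c%:Z + b%:Z * c%:Z).
Proof.
move=> hexp; have := exponents3_sum_ge hexp; have [f0 hd sqf] := hf.
move: hexp => /exponents3 [D [r [[<- <- <-] /andP[D01 D12] rmin rhom]]] dD.
have [P uP fP] := generic_frame f0 hd.
have [l [k0 [hl l0 hline]]] := good_line uP d1 hd sqf fP.
set sigma := (D 0%R + D 1%R + D 2%R)%N.
have ms : (d.-1 <= sigma)%N by rewrite /sigma; lia.
(* From [k1] on, [hline] applies, and [k - d.-1] is at least every [D j] and the degree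
   [sigma - d.-1] of the last term of the resolution. *)
pose k1 := (k0 + d.-1 + sigma)%N.
set c0 : int := RHS.
have hdim k : (k1 <= k)%N ->
    (\dim {:dhomog 3 K k})%:Z = (\dim (jacobian_piece f d.-1 k))%:Z + c0.
  move=> hk; have ek : (k = (k - d.-1) + d.-1)%N by rewrite subnK //; rewrite /k1 in hk; lia.
  have kD j : (D j <= k - d.-1)%N.
    by move: j; apply: forall_ord3; rewrite /k1 /sigma in hk; lia.
  have sk : (sigma - d.-1 <= k - d.-1)%N by rewrite /k1 in hk; lia.
  have := hilbert_polynomial_constant (kD 0%R) (kD 1%R) (kD 2%R) ms sk.
  have := dim_jacobian_piece d1 f0 hd sqf rmin rhom D01 D12 kD sk.
  rewrite -/sigma dim_dhomog -ek => /(congr1 Posz); rewrite !PoszD.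
  have d1z : (d.-1)%:Z = d%:Z - 1 by rewrite -subn1 -subzn // ltnW.
  rewrite d1z -/c0; move: (\dim _) c0 => x y.
  move: ('C(_, _)) ('C(_, _)) ('C(_, _)) ('C(_, _)) ('C(_, _)) ('C(_, _)) => *; lia.
(* [c0] is a difference of dimensions, so it is a natural number and can serve as [N]. *)
have c0ge : 0 <= c0.
  have := hdim k1 (leqnn _); have := dimvS (subvf (jacobian_piece f d.-1 k1)).
  by move: (\dim _) (\dim _) => *; lia.
rewrite -[RHS](gez0_abs c0ge); congr Posz.
apply: (total_tjurina_eq d1 hd hl l0 (k0 := k1)).
- by move=> k F hk; apply: hline; apply: leq_trans hk; rewrite /k1; lia.
- by rewrite /k1; lia.
- move=> k /hdim; rewrite -[X in _ + X](gez0_abs c0ge) -PoszD => -[->]; by [].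
Qed.

End ThreeSyzygyCurves.

Theorem proposition3p3 (R : realType) (d d1 d2 d3 : nat)
    (f : {mpoly R[i][3]}) (hd : (3 <= d)%N) (hf : reduced_curve d f)
    (hexp : exponents f [:: d1; d2; d3]) :
  let tau : int := (total_tjurina f)%:Z in
  let D : int := d%:Z in
  let D1 : int := d1%:Z in
  let D2 : int := d2%:Z in
  let D3 : int := d3%:Z in
  [/\ tau = (D - 1) ^+ 2 - D1 * (D - D1 - 1) - (D3 - D2 + 1)
            - (D1 + D2 - D) * (D1 + D3 - D + 2),
      tau = (D - 1) * (D - D1 - 1) + D1 ^+ 2
            - (D1 - (D - 1 - D2)) * (D1 - (D - 1 - D3)),
      tau <= (D - 1) ^+ 2 - D1 * (D - D1 - 1) - (D3 - D2 + 1) &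
      (tau = (D - 1) ^+ 2 - D1 * (D - D1 - 1) - (D3 - D2 + 1)
       <-> plus_one_generated d f)].
Proof.
have hd1 : (1 < d)%N by exact: leq_trans hd.
move=> tau D D1 D2 D3.
have etau : tau = (D - 1) * (D1 + D2 + D3) - (D1 * D2 + D1 * D3 + D2 * D3).
  exact: (total_tjurina_exponents hd1 hf hexp).
have ge : (d <= d1 + d2)%N := exponents3_sum_ge hd1 hf hexp.
have le23 : (d2 <= d3)%N by have [/= /and3P[]] := hexp.
have e1 : tau = (D - 1) ^+ 2 - D1 * (D - D1 - 1) - (D3 - D2 + 1)
            - (D1 + D2 - D) * (D1 + D3 - D + 2) by rewrite etau; ring.
have n12 : 0 <= D1 + D2 - D by rewrite /D1 /D2 /D; lia.
(* As [d1 + d3 >= d1 + d2 >= d], this factor of the defect cannot vanish. *)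
have p13 : 0 < D1 + D3 - D + 2 by rewrite /D1 /D3 /D; lia.
split=> //; first by rewrite etau; ring.
  by rewrite e1 gerBl mulr_ge0 // ltW.
split=> [|[a [b [c [hexp' eab]]]]].
  rewrite {1}e1 => /eqP; rewrite -subr_eq0 addrAC subrr add0r oppr_eq0 mulf_eq0.
  rewrite (gt_eqF p13) orbF => /eqP e0; exists d1, d2, d3; split=> //.
  by move: e0; rewrite /D1 /D2 /D; lia.
(* [plus_one_generated] supplies its own exponents, which uniqueness identifies with the given
   ones. *)
have [ea eb ec] := exponents3_unique hd1 hf hexp hexp'.
rewrite e1; have -> : D1 + D2 - D = 0 by rewrite /D1 /D2 /D ea eb; lia.
by rewrite mul0r subr0.
Qed.
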